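(* Let $d\in\mathbb{N}$ and let $(L_i)_{i\in\mathbb{N}}$ be a sequence of independent and identically distributed random matrices taking values in $\mathbb{C}^{d\times d}$ (or in a multiplicative semigroup $\mathcal{S}\subseteq\mathbb{C}^{d\times d}$) such that $\mathbb{E}\log^+\sigma_{\max}(L_1)<\infty$. Let $\mathbb{X}:=\{X\in\mathbb{C}^{d\times d}: X\ge 0,\ \operatorname{tr}X=1\}$. Then $$2\gamma_1\le\max_{X\in\mathbb{X}}\mathbb{E}\log\operatorname{tr}(XL_1L_1^\dagger)\le\log\max_{X\in\mathbb{X}}\mathbb{E}\operatorname{tr}(XL_1L_1^\dagger),$$ where the first bound is the value of a convex optimization problem (maximization of the concave function $X\mapsto\mathbb{E}\log\operatorname{tr}(XL_1L_1^\dagger)$ over the convex set $\mathbb{X}$), and the maximization in the second bound is a semidefinite program (maximization of the linear function $X\mapsto\mathbb{E}\operatorname{tr}(XL_1L_1^\dagger)$ over $\mathbb{X}$).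
   Context: $\log$ is the natural logarithm with $\log 0=-\infty$ (and $\log\infty=\infty$), $\log^+t=\max\{\log t,0\}$, $L^\dagger$ is the conjugate transpose of $L$, and $X\ge0$ means that $X$ is positive semidefinite. $\sigma_1=\sigma_{\max}$ denotes the largest singular value. The maximal Lyapunov exponent of the sequence $(L_i)_{i\in\mathbb{N}}$ is $$\gamma_1:=\lim_{n\to\infty}\frac1n\,\mathbb{E}\log\sigma_{\max}(L_1L_2\cdots L_n),$$ where the limit is known to exist in $[-\infty,\infty)$ under the stated assumptions.
   Formalization: That the second maximization is a semidefinite program is claimed only when E tr(X L_1 L_1†) is finite for all X in the feasible set; otherwise (e.g. d=1, E|L_1|²=∞) the objective is infinite and only linearity with values in [0,∞] is asserted. *)

(* Defs.v *)
From HB Require Import structures.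
From mathcomp Require Export all_boot all_order all_algebra finmap complex.
From mathcomp Require Export all_classical all_reals all_analysis.

Set Implicit Arguments.
Unset Strict Implicit.
Unset Printing Implicit Defensive.

Import Order.TTheory GRing.Theory Num.Theory.

Local Open Scope classical_set_scope.
Local Open Scope ring_scope.
Local Open Scope complex_scope.
Local Open Scope sesquilinear_scope.
Local Open Scope ereal_scope.

Section Matrices.
Context {R : realType} {d : nat}.
Local Notation C := R[i].
Local Notation M := 'M[C]_d.
Implicit Types (A X Y : M) (a b t : R) (f : M -> \bar R) (D : set M).

Definition psd X : Prop :=
  X \is hermsymmx /\ forall v : 'cV[C]_d, (0 <= (v ^t* *m X *m v) 0 0)%R.

Definition singular_values A : set R :=
  [set s : R | (0 <= s)%R /\ eigenvalue (A ^t* *m A) (s ^+ 2)%:C].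

(* For 0 < d the set is finite and nonempty, so this is its maximum. *)
Definition sigma_max A : R := sup (singular_values A).

(* Density matrices, the set written as a blackboard-bold X in the paper. *)
Definition density : set M := [set X | psd X /\ \tr X = 1%R].

(* The trace of X A A^dagger is a nonnegative real when X is psd; the real
   part only serves to land in R. *)
Definition trXAA X A : R := complex.Re (\tr (X *m A *m A ^t*)).

(* Borel sigma-algebra of C^(d x d), identified with R^(2 d^2): generated by
   the real and imaginary parts of the entries. *)
Definition mx_borel : set (set M) :=
  <<s [set E | exists i j (B : set R), measurable B /\
         (E = (fun A => complex.Re (A i j)) @^-1` B \/
          E = (fun A => complex.Im (A i j)) @^-1` B)] >>.

(* Concavity for [-oo, +oo)-valued functions; excluding +oo on D keeps the
   sum below free of the form +oo - oo. *)
Definition concave_on D f : Prop :=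
  (forall X, D X -> f X < +oo) /\
  forall X Y t, D X -> D Y -> (0 <= t <= 1)%R ->
    t%:E * f X + (1 - t)%:E * f Y <= f (t%:C *: X + (1 - t)%:C *: Y)%R.

(* Linearity of a [0, +oo]-valued function on the psd cone (0 * +oo = 0). *)
Definition linear_on_psd f : Prop :=
  forall X Y a b, psd X -> psd Y -> (0 <= a)%R -> (0 <= b)%R ->
    f (a%:C *: X + b%:C *: Y)%R = a%:E * f X + b%:E * f Y.

(* Maximizing f over D is a semidefinite program in standard form:
   maximize tr(G X) subject to tr(H_k X) = c_k for k < m and X psd,
   with Hermitian data G, H_k and real c_k. *)
Definition semidefinite_program D f : Prop :=
  exists (G : M) (m : nat) (H : 'I_m -> M) (c : 'I_m -> R),
    [/\ G \is hermsymmx, forall k, H k \is hermsymmx,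
        D = [set X | psd X /\ forall k, \tr (H k *m X) = (c k)%:C] &
        forall X, D X -> f X = (complex.Re (\tr (G *m X)))%:E].

(* v is the maximum (attained) of f over D. *)
Definition is_max D f (v : \bar R) : Prop :=
  (f @` D) v /\ ubound (f @` D) v.

End Matrices.

Section RandomMatrices.
Context {R : realType} {disp : measure_display} {T : measurableType disp}.
Context (P : probability T R) {d : nat}.
Local Notation M := 'M[R[i]]_d.
Implicit Types (L : nat -> T -> M) (A : T -> M) (X : M).

Definition random_matrix A : Prop :=
  forall B, mx_borel B -> measurable (A @^-1` B).

Definition independent_matrices L : Prop :=
  forall (J : {fset nat}) (B : nat -> set M), (forall i, mx_borel (B i)) ->
    P (\bigcap_(i in [set` J]) (L i @^-1` B i)) =
    \prod_(i <- J) P (L i @^-1` B i).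

Definition identically_distributed L : Prop :=
  forall i j B, mx_borel B -> P (L i @^-1` B) = P (L j @^-1` B).

Definition ex_log_plus_sigma A : \bar R :=
  \int[P]_w maxe (lne (sigma_max (A w))%:E) 0.

(* The paper's L_1, L_2, ... are L 0, L 1, ... *)
Definition lyapunov_seq L (n : nat) : \bar R :=
  (n%:R^-1)%:E *
  \int[P]_w lne (sigma_max (\big[mulmx/1%:M]_(i < n) L i w))%:E.

Definition lyapunov_max L : \bar R := limn (lyapunov_seq L).

Definition ex_log_tr A X : \bar R := \int[P]_w lne (trXAA X (A w))%:E.

Definition ex_tr A X : \bar R := \int[P]_w (trXAA X (A w))%:E.

End RandomMatrices.

(* Main.v *)
(* Let v_1 be the first maximum.  The first bound comes from the unnormalised
   recursion t_n = tr(B_n B_n^dagger), B_n = L_1 ... L_n: with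
   Y_n = B_n^dagger B_n one has t_{n+1} = tr(Y_n L_{n+1} L_{n+1}^dagger), where Y_n
   is independent of L_{n+1}; rescaling Y_n to a density matrix and integrating
   first over L_{n+1} gives E log t_{n+1} <= E log t_n + v_1, hence
   2 E log sigma_max(B_n) <= E log t_n <= log d + n v_1.  The limit exists by
   Fekete's lemma, the maxima are attained by compactness of the set of density
   matrices and the reverse Fatou lemma, and the second bound is Jensen's
   inequality, read off the tangent lines of log. *)
From HB Require Import structures.
Require Import Defs.
From mathcomp Require Import ring lra measurable_realfun.

Set Implicit Arguments.
Unset Strict Implicit.
Unset Printing Implicit Defensive.

Import Order.TTheory GRing.Theory Num.Theory.
Import numFieldNormedType.Exports.

Local Open Scope classical_set_scope.
Local Open Scope ring_scope.
Local Open Scope complex_scope.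
Local Open Scope sesquilinear_scope.

(** * Spectral theorem for Gram matrices *)

Section ComplexMatrices.
Context {R : realType}.
Local Notation C := R[i].

(** The trace replaces the squared largest singular value because it is linear in Y_n, so a bound
    over density matrices applies after rescaling; the cost is the factor t_0 = d, which 1/n
    removes. Two obstacles shape the rest. Logarithms of singular values may be -oo, even with
    positive probability, so additivity, Fubini and Fatou are established for functions whose
    positive part alone has finite integral. And independence is a product formula for events,
    whereas the recursion needs an iterated integral: the sequence is replaced by one of equal law
    on a product space, where the next matrix lives on its own factor, and equality of laws is
    checked on cylinders. The recursion is run twice: with the crude bound 2 E log^+ sigma_max it
    yields the integrability behind Fekete's lemma, and with v_1 the bound itself. The second
    maximum may be +oo, so the semidefinite form is derived under finiteness of the objective. *)

Lemma adjmxM m n p (A : 'M[C]_(m, n)) (B : 'M[C]_(n, p)) :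
  (A *m B)^t* = B^t* *m A^t*.
Proof. by rewrite trmx_mul map_mxM. Qed.

Lemma adjmxK m n (A : 'M[C]_(m, n)) : (A^t*)^t* = A.
Proof. exact: trmxCK. Qed.

Lemma Re_ge0E (z : C) : 0 <= z -> (complex.Re z)%:C = z.
Proof. by move=> z0; apply/RRe_real/ger0_real. Qed.

Lemma Re_le (x y : C) : x <= y -> complex.Re x <= complex.Re y.
Proof. by rewrite lecE => /andP[]. Qed.

Lemma mxtrace_gram m n (B : 'M[C]_(m, n)) :
  \tr (B *m B^t*) = \sum_i \sum_j `|B i j| ^+ 2.
Proof.
rewrite /mxtrace; apply: eq_bigr => i _; rewrite !mxE.
by apply: eq_bigr => j _; rewrite !mxE -normCK.
Qed.

Lemma mxtrace_gram_ge0 m n (B : 'M[C]_(m, n)) : 0 <= \tr (B *m B^t*).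
Proof.
by rewrite mxtrace_gram; apply: sumr_ge0 => i _; apply: sumr_ge0 => j _;
  rewrite exprn_ge0.
Qed.

Lemma mx11_tr (B : 'M[C]_1) : B 0 0 = \tr B.
Proof. by rewrite /mxtrace big_ord1. Qed.

Lemma row_gram_gt0 n (v : 'rV[C]_n) : v != 0 -> 0 < \tr (v *m v^t*).
Proof.
move=> v0; rewrite lt_def mxtrace_gram_ge0 andbT.
apply: contraNneq v0; rewrite mxtrace_gram big_ord1 => /eqP.
rewrite psumr_eq0 => [/allP v0|i _]; last by rewrite exprn_ge0.
apply/eqP/rowP => j; rewrite mxE; apply/eqP.
by move: (v0 j (mem_index_enum j)); rewrite sqrf_eq0 normr_eq0.
Qed.

(** Eigenvectors are rows, so v A^† A = l v; multiplying by v^† compares the squared norms of v A^†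
    and of v. *)
Lemma eigenvalue_gramP m n (A : 'M[C]_(m, n)) (l : C) :
  eigenvalue (A^t* *m A) l ->
  exists2 v : 'rV[C]_n, v != 0 & \tr ((v *m A^t*) *m (v *m A^t*)^t*) =
    l * \tr (v *m v^t*).
Proof.
case/eigenvalueP=> v vA v0; exists v => //.
by rewrite adjmxM adjmxK mulmxA -(mulmxA v) vA -scalemxAl mxtraceZ.
Qed.

Lemma eigenvalue_gram_ge0 m n (A : 'M[C]_(m, n)) (l : C) :
  eigenvalue (A^t* *m A) l -> 0 <= l.
Proof.
case/eigenvalue_gramP=> v /row_gram_gt0 v0 E.
by rewrite -(pmulr_lge0 _ v0) -E mxtrace_gram_ge0.
Qed.

Lemma gram_hermsym m n (A : 'M[C]_(m, n)) : A^t* *m A \is hermsymmx.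
Proof. by apply/is_hermitianmxP; rewrite expr0 scale1r adjmxM adjmxK. Qed.

Section Spectral.
Context {n : nat} {N : 'M[C]_n} (N_herm : N \is hermsymmx).
Let U := spectralmx N.
Let l := spectral_diag N.

Let UU : U *m U^t* = 1%:M.
Proof. by apply/unitarymxP/spectral_unitarymx. Qed.

Let UtU : U^t* *m U = 1%:M.
Proof. exact/mulmx1C/UU. Qed.

Lemma hermitian_spectral : N = U^t* *m diag_mx l *m U.
Proof.
rewrite -invmx_unitary ?spectral_unitarymx//.
exact/orthomx_spectralP/hermitian_normalmx.
Qed.

Let rowU_neq0 i : row i U != 0.
Proof.
apply: contraTneq (oner_neq0 C) => Ui; rewrite negbK; apply/eqP.
have <- : (U *m U^t*) i i = 1 by rewrite UU mxE eqxx.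
rewrite mxE; apply: big1 => j _; move/rowP/(_ j): Ui; rewrite !mxE => ->; exact: mul0r.
Qed.

Lemma eigenvalue_spectral_diag i : eigenvalue N (l 0 i).
Proof.
apply/eigenvalueP; exists (row i U) => //.
rewrite [in LHS]hermitian_spectral -!row_mul !mulmxA UU mul1mx.
by rewrite row_mul row_diag_mx -scalemxAl rowE.
Qed.

Lemma eigenvalue_spectralP a : eigenvalue N a -> exists i, a = l 0 i.
Proof.
case/eigenvalueP => v; rewrite [in X in X -> _]hermitian_spectral => vN v0.
have w0 : v *m U^t* != 0.
  apply: contra_neq v0 => w0.
  by rewrite -(mulmx1 v) -UtU mulmxA w0 mul0mx.
have [i wi] : exists i, (v *m U^t*) 0 i != 0.
  apply/existsP; apply: contraNT w0 => /existsPn w0.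
  by apply/eqP/rowP => i; rewrite [RHS]mxE; apply/eqP; move: (w0 i); rewrite negbK.
exists i; move/(congr1 (fun w => (w *m U^t*) 0 i)): vN.
rewrite -!mulmxA UU mulmx1 mulmxA mul_mx_diag -scalemxAl.
rewrite mxE [RHS]mxE mulrC => E.
by have /mulIf := wi; apply; rewrite -E.
Qed.

(** In an eigenbasis of [N] the eigenvalues are weighted by the diagonal of the conjugated [X]. For
    psd [X] these weights are nonnegative with sum tr X, which turns eigenvalue bounds into trace
    bounds. *)
Lemma mxtrace_spectral (X : 'M[C]_n) :
  \tr (X *m N) = \sum_i l 0 i * (U *m X *m U^t*) i i.
Proof.
rewrite {1}hermitian_spectral mulmxA mxtrace_mulC !mulmxA.
rewrite mxtrace_mulC.
have -> : diag_mx l *m (U *m X *m U^t*) = \matrix_(i, j) (l 0 i * (U *m X *m U^t*) i j).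
  by rewrite mul_diag_mx.
by apply: eq_bigr => i _; rewrite mxE.
Qed.

Lemma mxtrace_unitary_conj (X : 'M[C]_n) : \tr (U *m X *m U^t*) = \tr X.
Proof. by rewrite mxtrace_mulC mulmxA UtU mul1mx. Qed.

Lemma mxtrace_iter_spectral k :
  \tr (iter k (mulmx N) 1%:M) = \sum_i l 0 i ^+ k.
Proof.
have -> : iter k (mulmx N) 1%:M = U^t* *m diag_mx (\row_i l 0 i ^+ k) *m U.
  elim: k => [|k IH] /=.
    have -> : diag_mx (\row_i l 0 i ^+ 0) = 1%:M.
      by apply/matrixP => i j; rewrite !mxE expr0.
    by rewrite mulmx1 UtU.
  rewrite IH {1}hermitian_spectral !mulmxA; congr (_ *m _).
  rewrite -[_ *m U *m U^t*]mulmxA UU mulmx1 -mulmxA; congr (_ *m _).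
  rewrite mul_diag_mx; apply/matrixP => i j; rewrite !mxE exprS.
  by rewrite mulrnAr.
rewrite mxtrace_mulC mulmxA UU mul1mx mxtrace_diag.
by apply: eq_bigr => i _; rewrite mxE.
Qed.

End Spectral.

End ComplexMatrices.

(** * Largest singular value and density matrices *)

Section SigmaMax.
Context {R : realType} {d : nat} (d_gt0 : (0 < d)%N).
Local Notation C := R[i].
Local Notation M := 'M[C]_d.
Implicit Types (A B X Y : M).

Lemma eigenvalue_gram_le_tr A (l : C) :
  eigenvalue (A^t* *m A) l -> l <= \tr (A *m A^t*).
Proof.
move=> /(eigenvalue_spectralP (gram_hermsym A)) [i ->].
have := mxtrace_iter_spectral (gram_hermsym A) 1.
rewrite /= mulmx1 mxtrace_mulC => ->.
rewrite (bigD1 i)//= expr1 lerDl sumr_ge0// => j _; rewrite expr1.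
exact/eigenvalue_gram_ge0/eigenvalue_spectral_diag/gram_hermsym.
Qed.

Lemma singular_value_sqrt A (l : C) : eigenvalue (A^t* *m A) l ->
  singular_values A (Num.sqrt (complex.Re l)).
Proof.
move=> Al; have l0 := eigenvalue_gram_ge0 Al; split; first exact: sqrtr_ge0.
by rewrite sqr_sqrtr ?Re_ge0E//; have := Re_le l0.
Qed.

Lemma singular_values_has_sup A : has_sup (singular_values A).
Proof.
split.
  (* Positivity of [d] supplies an index, hence an eigenvalue, so the supremum is not a default
     value. *)
  eexists; apply: singular_value_sqrt.
  exact: (eigenvalue_spectral_diag (gram_hermsym A) (Ordinal d_gt0)).
exists (Num.sqrt (complex.Re (\tr (A *m A^t*)))) => s [s0].
move=> /eigenvalue_gram_le_tr /Re_le /= sA.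
by rewrite -(ger0_norm s0) -sqrtr_sqr ler_wsqrtr.
Qed.

Lemma sigma_max_ge0 A : 0 <= sigma_max A.
Proof.
have [[s sA] ub] := singular_values_has_sup A.
by apply: le_trans (ub_le_sup ub sA); case: sA.
Qed.

Lemma eigenvalue_le_sigma_max A (l : C) : eigenvalue (A^t* *m A) l ->
  l <= (sigma_max A ^+ 2)%:C.
Proof.
move=> Al; have l0 := eigenvalue_gram_ge0 Al; have r0 := Re_le l0.
rewrite -(Re_ge0E l0) lecR -[leLHS]sqr_sqrtr//.
rewrite lerXn2r ?nnegrE ?sqrtr_ge0 ?sigma_max_ge0//.
by apply: ub_le_sup (singular_value_sqrt Al); case: (singular_values_has_sup A).
Qed.

Lemma sigma_max_le A (c : R) : 0 <= c ->
  (forall l : C, eigenvalue (A^t* *m A) l -> l <= (c ^+ 2)%:C) -> sigma_max A <= c.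
Proof.
move=> c0 Ac; apply: ge_sup; first by case: (singular_values_has_sup A).
move=> s [s0 /Ac]; rewrite lecR.
by rewrite ler_pXn2r.
Qed.

Lemma sqr_sigma_max_le A (c : R) : 0 <= c ->
  (forall l : C, eigenvalue (A^t* *m A) l -> l <= c%:C) -> sigma_max A ^+ 2 <= c.
Proof.
move=> c0 Ac; rewrite -(sqr_sqrtr c0) lerXn2r ?nnegrE ?sigma_max_ge0//.
by apply: sigma_max_le => // l /Ac; rewrite sqr_sqrtr.
Qed.

Lemma sigma_max_sqr_le_tr A : sigma_max A ^+ 2 <= complex.Re (\tr (A *m A^t*)).
Proof.
apply: sqr_sigma_max_le; first exact: Re_le (mxtrace_gram_ge0 A).
by move=> l /eigenvalue_gram_le_tr; rewrite Re_ge0E// mxtrace_gram_ge0.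
Qed.

(** [sigma_max] acts as an operator norm: in an eigenbasis of A^† A each eigenvalue is at most its
    square, and the weights are squared moduli of the coordinates of [v]. *)
Lemma tr_gram_adj_le A (v : 'rV[C]_d) :
  \tr ((v *m A^t*) *m (v *m A^t*)^t*) <= (sigma_max A ^+ 2)%:C * \tr (v *m v^t*).
Proof.
have -> : \tr ((v *m A^t*) *m (v *m A^t*)^t*) = \tr ((v^t* *m v) *m (A^t* *m A)).
  by rewrite adjmxM adjmxK -[in LHS]mulmxA [LHS]mxtrace_mulC [RHS]mxtrace_mulC !mulmxA.
have -> : \tr (v *m v^t*) = \tr (v^t* *m v) by rewrite mxtrace_mulC.
have H := gram_hermsym A.
rewrite (mxtrace_spectral H) -(mxtrace_unitary_conj (N := A^t* *m A)) mulr_sumr.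
apply: ler_sum => i _; apply: ler_wpM2r.
  set U := spectralmx _.
  have -> : U *m (v^t* *m v) *m U^t* = (v *m U^t*)^t* *m (v *m U^t*).
    by rewrite adjmxM adjmxK !mulmxA.
  by rewrite mxE; apply: sumr_ge0 => k _; rewrite !mxE mulrC -normCK exprn_ge0.
exact/eigenvalue_le_sigma_max/eigenvalue_spectral_diag.
Qed.

(** An eigenvector of (AB)^† AB is multiplied by B^† and then by A^†; the norm bound applies to each
    factor in turn. *)
Lemma sigma_maxM A B : sigma_max (A *m B) <= sigma_max A * sigma_max B.
Proof.
apply: sigma_max_le; first by rewrite mulr_ge0 ?sigma_max_ge0.
move=> l /eigenvalue_gramP [v v0 E].
rewrite -(ler_pM2r (row_gram_gt0 v0)) -E (adjmxM A B) mulmxA.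
apply: (le_trans (tr_gram_adj_le _ _)).
have -> : ((sigma_max A * sigma_max B) ^+ 2)%:C =
    (sigma_max A ^+ 2)%:C * (sigma_max B ^+ 2)%:C by rewrite exprMn rmorphM.
rewrite -mulrA; apply: ler_wpM2l; first by rewrite ler0c exprn_ge0// sigma_max_ge0.
exact: tr_gram_adj_le.
Qed.

Lemma sigma_max1 : sigma_max (1%:M : M) = 1.
Proof.
have E : (1%:M : M)^t* *m 1%:M = 1%:M by rewrite mulmx1 trmx1 map_mx1.
have ev (l : C) : eigenvalue ((1%:M : M)^t* *m 1%:M) l -> l = 1.
  rewrite E => /eigenvalueP [v]; rewrite mulmx1 => vl v0.
  have : (l - 1) *: v == 0 by rewrite scalerBl scale1r -vl subrr.
  by rewrite scaler_eq0 (negbTE v0) orbF subr_eq0 => /eqP.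
apply/eqP; rewrite eq_le; apply/andP; split.
  by apply: sigma_max_le => // l /ev ->; rewrite expr1n.
have := eigenvalue_spectral_diag (gram_hermsym (1%:M : M)) (Ordinal d_gt0).
move=> /[dup] /ev -> /eigenvalue_le_sigma_max; rewrite -[1]/(1%:C) lecR.
by rewrite -[leLHS](expr1n _ 2) ler_pXn2r ?nnegrE ?sigma_max_ge0.
Qed.

(* Countably many polynomial conditions, hence the measurability of [sigma_max]. *)
Lemma sigma_max_leP A (c : R) : 0 <= c ->
  sigma_max A <= c <->
  forall k, complex.Re (\tr (iter k (mulmx (A^t* *m A)) 1%:M)) <= d%:R * (c ^+ 2) ^+ k.
Proof.
move=> c0; have H := gram_hermsym A.
have l0 i := eigenvalue_gram_ge0 (eigenvalue_spectral_diag H i).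
have trE k : complex.Re (\tr (iter k (mulmx (A^t* *m A)) 1%:M)) =
    \sum_i complex.Re (spectral_diag (A^t* *m A) 0 i) ^+ k.
  rewrite mxtrace_iter_spectral// -[LHS]/(complex.Re _); apply: complexI.
  rewrite Re_ge0E; last by apply: sumr_ge0 => i _; rewrite exprn_ge0.
  rewrite rmorph_sum; apply: eq_bigr => i _; by rewrite rmorphXn /= Re_ge0E.
split=> [Ac k|Ac].
  rewrite trE -[d in d%:R]card_ord -sum1_card natr_sum mulr_suml; apply: ler_sum => i _.
  rewrite mul1r; apply: lerXn2r; rewrite ?nnegrE ?exprn_ge0//; first exact: Re_le (l0 i).
  rewrite -lecR Re_ge0E//;
  apply: (le_trans (eigenvalue_le_sigma_max (eigenvalue_spectral_diag H i))).
  by rewrite lecR lerXn2r ?nnegrE// sigma_max_ge0.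
apply: sigma_max_le => // l /(eigenvalue_spectralP H) [i ->].
rewrite -(Re_ge0E (l0 i)) lecR leNgt; apply/negP => lc.
set r := complex.Re _ in lc.
have bnd k : r ^+ k <= d%:R * (c ^+ 2) ^+ k.
  rewrite (le_trans _ (Ac k))// trE (bigD1 i)//= lerDl sumr_ge0// => j _.
  by rewrite exprn_ge0//; exact: Re_le (l0 j).
have r0 : 0 < r by rewrite (le_lt_trans _ lc)// exprn_ge0.
have [c20|c2n0] := eqVneq (c ^+ 2) 0.
  by have := bnd 1%N; rewrite c20 expr1 mulr0 leNgt r0.
have c2 : 0 < c ^+ 2 by rewrite lt_def c2n0 exprn_ge0.
(* If an eigenvalue [r] exceeded c^2, Bernoulli's inequality would make (r / c^2)^k grow at least
   linearly with slope [x], past the constant [d] that bounds it. *)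
pose x := r / c ^+ 2 - 1.
have x0 : 0 < x by rewrite subr_gt0 ltr_pdivlMr// mul1r.
have [k kP] : exists k : nat, d%:R < k%:R * x.
  exists (Num.bound (d%:R / x)); rewrite -ltr_pdivrMr//.
  by apply: le_lt_trans (archi_boundP _); rewrite ?divr_ge0// ltW.
have bern : 1 + k%:R * x <= (1 + x) ^+ k.
  elim: (k) => [|m IH]; first by rewrite mul0r addr0.
  rewrite exprS -natr1; apply: le_trans (ler_wpM2l _ IH); last by lra.
  have : 0 <= m%:R * x * x by rewrite !mulr_ge0 ?(ltW x0).
  by nra.
have : (r / c ^+ 2) ^+ k <= d%:R by rewrite expr_div_n ler_pdivrMr ?(exprn_gt0 k c2)//; exact: bnd.
have -> : r / c ^+ 2 = 1 + x by rewrite /x addrC subrK.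
by move=> /(le_trans bern); lra.
Qed.

Lemma psd_gram_adj n (A : 'M[C]_(n, d)) : psd (A^t* *m A).
Proof.
split=> [|v]; first exact: gram_hermsym.
rewrite mx11_tr.
have -> : v^t* *m (A^t* *m A) *m v = (A *m v)^t* *m (A *m v) by rewrite adjmxM !mulmxA.
by rewrite mxtrace_mulC mxtrace_gram_ge0.
Qed.

(** By cyclicity this is tr (A^† X A), a sum of values of the quadratic form of [X] at the columns
    of [A]. *)
Lemma psd_tr_ge0 X A : psd X -> 0 <= \tr (X *m A *m A^t*).
Proof.
case=> _ X0; rewrite mxtrace_mulC mulmxA; apply: sumr_ge0 => i _.
have := X0 (col i A); congr (0 <= _).
by rewrite tr_col map_row -row_mul mxE [RHS]mxE; apply: eq_bigr => k _; rewrite !mxE.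
Qed.

Lemma psd_trace_ge0 X : psd X -> 0 <= \tr X.
Proof.
move=> /(psd_tr_ge0 1%:M).
by rewrite trmx1 map_mx1 !mulmx1.
Qed.

Lemma psd_tr_le X A : psd X ->
  \tr (X *m A *m A^t*) <= (sigma_max A ^+ 2)%:C * \tr X.
Proof.
move=> [Xh X0]; have H : A *m A^t* \is hermsymmx.
  by have := gram_hermsym (A^t*); rewrite adjmxK.
rewrite -mulmxA (mxtrace_spectral H) -(mxtrace_unitary_conj (N := A *m A^t*) X).
rewrite mulr_sumr; apply: ler_sum => i _; apply: ler_wpM2r.
  set U := spectralmx _.
  have := X0 (col i (U^t*)); congr (0 <= _).
  rewrite tr_col map_row adjmxK -row_mul mxE [RHS]mxE.
  by apply: eq_bigr => k _; rewrite !mxE.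
have := eigenvalue_spectral_diag H i; set l := spectral_diag _ 0 i.
case/eigenvalueP=> v vl v0.
have [->|l0] := eqVneq l 0; first by rewrite ler0c exprn_ge0// sigma_max_ge0.
(* [sigma_max] refers to A^† A: a nonzero eigenvalue passes there from A A^† along the map sending v
   to v A. *)
apply: eigenvalue_le_sigma_max; apply/eigenvalueP; exists (v *m A).
  by rewrite mulmxA -(mulmxA v) vl scalemxAl.
apply: contraNneq v0 => vA; move: vl; rewrite mulmxA vA mul0mx => /esym/eqP.
by rewrite scaler_eq0 (negbTE l0).
Qed.

Lemma trXAA_ge0 X A : psd X -> 0 <= trXAA X A.
Proof. by move=> /(psd_tr_ge0 A) /Re_le. Qed.

Lemma trXAA_le X A : psd X -> trXAA X A <= sigma_max A ^+ 2 * complex.Re (\tr X).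
Proof.
move=> Xp; have := Re_le (psd_tr_le A Xp).
by rewrite -{1}(Re_ge0E (psd_trace_ge0 Xp)) -rmorphM.
Qed.

Lemma trXAA_density_le X A : density X -> trXAA X A <= sigma_max A ^+ 2.
Proof. by case=> /(trXAA_le A) + E; rewrite E mulr1. Qed.

Lemma trXAAD X Y A : trXAA (X + Y) A = trXAA X A + trXAA Y A.
Proof. by rewrite /trXAA !mulmxDl !raddfD. Qed.

Lemma trXAAZ (a : R) X A : trXAA (a%:C *: X) A = a * trXAA X A.
Proof.
rewrite /trXAA -!scalemxAl mxtraceZ; case: (\tr _) => x y /=.
by rewrite mul0r subr0.
Qed.

Lemma psd_comb (a b : R) X Y : 0 <= a -> 0 <= b -> psd X -> psd Y ->
  psd (a%:C *: X + b%:C *: Y).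
Proof.
move=> a0 b0 [Xh X0] [Yh Y0]; split=> [|v].
  move/is_hermitianmxP: Xh; move/is_hermitianmxP: Yh.
  rewrite !expr0 !scale1r => Yh Xh; apply/is_hermitianmxP; rewrite expr0 scale1r.
  apply/matrixP => i j; move/matrixP/(_ i j): Xh; move/matrixP/(_ i j): Yh.
  rewrite !mxE => -> ->; rewrite rmorphD !rmorphM /=.
  by congr (_ * _ + _ * _); exact/esym/conjc_real.
rewrite mulmxDr mulmxDl -!scalemxAr -!scalemxAl !mxE addr_ge0// mulr_ge0 ?ler0c//.
- by have := X0 v; rewrite !mxE.
- by have := Y0 v; rewrite !mxE.
Qed.

Lemma density_conv (t : R) X Y : 0 <= t <= 1 -> density X -> density Y ->
  density (t%:C *: X + (1 - t)%:C *: Y).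
Proof.
move=> /andP[t0 t1] [Xp X1] [Yp Y1]; split; first by apply: psd_comb; rewrite ?subr_ge0.
by rewrite mxtraceD !mxtraceZ X1 Y1 !mulr1 -rmorphD addrC subrK.
Qed.

Lemma psd1 : psd (1%:M : M).
Proof. by have := psd_gram_adj (1%:M : M); rewrite trmx1 map_mx1 mulmx1. Qed.

Lemma psd_scale (a : R) X : 0 <= a -> psd X -> psd (a%:C *: X).
Proof. by move=> a0 Xp; have := psd_comb a0 (lexx 0) Xp Xp; rewrite scale0r addr0. Qed.

Lemma psd_normalize X : psd X -> 0 < complex.Re (\tr X) ->
  density ((complex.Re (\tr X))^-1%:C *: X).
Proof.
move=> Xp t0; split; first by apply: psd_scale => //; rewrite invr_ge0 ltW.
rewrite mxtraceZ -{2}(Re_ge0E (psd_trace_ge0 Xp)) -rmorphM mulVf//.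
exact: lt0r_neq0.
Qed.

(** The maximally mixed state: it shows that the set is inhabited, and up to the factor [d] its
    trace functional dominates that of every density matrix. *)
Lemma density_mixed : density ((d%:R^-1)%:C *: 1%:M : M).
Proof.
have := psd_normalize psd1; rewrite mxtrace1.
rewrite -(rmorph_nat (real_complex R)) /=; apply.
by rewrite ltr0n.
Qed.

End SigmaMax.

(** * Integrals of functions with integrable positive part *)

Section QuasiIntegral.
Local Open Scope ereal_scope.
Context d (T : measurableType d) (R : realType).
Implicit Types (mu : {measure set T -> \bar R}) (f g h : T -> \bar R).

(** The integral may be -oo, as happens for logarithms of singular values. Excluding the value +oo
    pointwise keeps sums of two such functions free of the form oo - oo. *)
Definition qintegrable mu f :=
  [/\ measurable_fun setT f, forall x, f x < +oo & \int[mu]_x f^\+ x < +oo].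

(** Positive and negative parts are ordered in opposite directions, and subtraction of extended
    reals is monotone under the convention oo - oo = -oo, so infinite integrals do no harm. *)
Lemma le_integral_qintegrable mu f g : measurable_fun setT f -> measurable_fun setT g ->
  (forall x, f x <= g x) -> \int[mu]_x f x <= \int[mu]_x g x.
Proof.
move=> mf mg fg; rewrite (integralE _ _ f) (integralE _ _ g); apply: leeB.
  apply: ge0_le_integral => //; try exact: measurable_funepos.
  by move=> x _; apply: (@funepos_le _ _ setT) => //; rewrite inE.
apply: ge0_le_integral => //; try exact: measurable_funeneg.
by move=> x _; apply: (@funeneg_le _ _ setT) => //; rewrite inE.
Qed.

Lemma qintegrable_ge0 mu f : measurable_fun setT f -> (forall x, f x < +oo) ->
  (forall x, 0 <= f x) -> \int[mu]_x f x < +oo -> qintegrable mu f.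
Proof.
move=> mf fy f0 If; split=> //.
rewrite (eq_integral f)// => x _; rewrite (@ge0_funeposE _ _ setT)//.
by rewrite inE.
Qed.

Lemma qintegrable_le mu f g : measurable_fun setT f -> qintegrable mu g ->
  (forall x, f x <= g x) -> qintegrable mu f.
Proof.
move=> mf [mg gy Ig] fg; split => // [x|]; first exact: le_lt_trans (fg x) (gy x).
apply: le_lt_trans Ig; apply: ge0_le_integral => //; try exact: measurable_funepos.
by move=> x _; apply: (@funepos_le _ _ setT) => //; rewrite inE.
Qed.

Lemma qintegrable_lty mu f : qintegrable mu f -> \int[mu]_x f x < +oo.
Proof.
move=> [mf _ If]; rewrite integralE; apply: le_lt_trans If.
by rewrite -[leRHS]sube0; apply: leeB => //; exact: integral_ge0.
Qed.

Lemma qintegrable_cst (P : probability T R) (c : \bar R) : c < +oo ->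
  qintegrable P (cst c).
Proof.
move=> cy; split=> //.
rewrite (eq_integral (cst (maxe c 0))); last by move=> x _; rewrite funeposE.
by rewrite integral_cst// [X in _ * X](probability_setT P) mule1 gt_max cy ltry.
Qed.

Lemma integral_cst_probability (P : probability T R) (c : \bar R) :
  \int[P]_x (cst c) x = c.
Proof. by rewrite integral_cst// [X in _ * X](probability_setT P) mule1. Qed.

Lemma funeposD_le f g x : (f \+ g)^\+ x <= f^\+ x + g^\+ x.
Proof.
rewrite !funeposE ge_max; apply/andP; split.
  by apply: leeD; rewrite le_max lexx.
by apply: adde_ge0; rewrite le_max lexx orbT.
Qed.

Lemma qintegrableD mu f g : qintegrable mu f -> qintegrable mu g ->
  qintegrable mu (f \+ g).
Proof.
move=> [mf fy If] [mg gy Ig]; split; first exact: emeasurable_funD.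
  by move=> x; exact: lte_add_pinfty.
have mfp := measurable_funepos mf; have mgp := measurable_funepos mg.
apply: (@le_lt_trans _ _ (\int[mu]_x (f^\+ x + g^\+ x))).
  apply: ge0_le_integral => //.
  - exact/measurable_funepos/emeasurable_funD.
  - exact: emeasurable_funD.
  - by move=> x _; exact: funeposD_le.
by rewrite ge0_integralD//; exact: lte_add_pinfty.
Qed.

(** Integrate the identity (f+g)^+ + f^- + g^- = (f+g)^- + f^+ + g^+, whose terms are all
    nonnegative, and regroup; the integrals of the positive parts are finite and may be moved
    across. *)
Lemma integral_qintegrableD mu f g : qintegrable mu f -> qintegrable mu g ->
  \int[mu]_x (f x + g x) = \int[mu]_x f x + \int[mu]_x g x.
Proof.
move=> qf qg; have [mfg fgy Ifg] := qintegrableD qf qg.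
case: qf qg => [mf fy If] [mg gy Ig].
have mfp := measurable_funepos mf; have mgp := measurable_funepos mg.
have mfn := measurable_funeneg mf; have mgn := measurable_funeneg mg.
have mfgn := measurable_funeneg mfg; have mfgp := measurable_funepos mfg.
have : \int[mu]_x ((f \+ g)^\+ x + (f^\- x + g^\- x)) =
       \int[mu]_x ((f \+ g)^\- x + (f^\+ x + g^\+ x)).
  apply: eq_integral => x _; rewrite !(funeposE, funenegE) /=.
  move: (fy x) (gy x); case: (f x) => [a| |] // _; case: (g x) => [b| |] // _ /=;
    rewrite ?maxNye ?maxeNy ?maxye ?maxey ?addye ?addey//;
    try by rewrite -ltNye; apply: lt_le_trans (ltNyr 0%R) _; rewrite ?adde_ge0 ?le_max ?lexx ?orbT.
  rewrite -?EFinN -?EFin_max -?EFinD; congr EFin.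
  have maxE (r : R) : Num.max r 0%R = (Num.max (- r) 0 + r)%R.
    by rewrite addr_maxl addNr add0r maxC.
  by rewrite (maxE (a + b)%R) (maxE a) (maxE b); ring.
move=> E; rewrite !(ge0_integralD mu measurableT) in E => //;
  try by [exact: emeasurable_funD|move=> *; exact: adde_ge0].
move: E.
rewrite -[\int[mu]_x (f x + g x)]/(\int[mu]_x ((f \+ g) x)).
rewrite (integralE _ _ (f \+ g)) (integralE _ _ f) (integralE _ _ g).
have Ap0 : 0 <= \int[mu]_x (f \+ g)^\+ x by exact: integral_ge0.
have An0 : 0 <= \int[mu]_x (f \+ g)^\- x by exact: integral_ge0.
have Fp0 : 0 <= \int[mu]_x f^\+ x by exact: integral_ge0.
have Fn0 : 0 <= \int[mu]_x f^\- x by exact: integral_ge0.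
have Gp0 : 0 <= \int[mu]_x g^\+ x by exact: integral_ge0.
have Gn0 : 0 <= \int[mu]_x g^\- x by exact: integral_ge0.
move: Ifg If Ig Ap0 An0 Fp0 Fn0 Gp0 Gn0.
move: (\int[mu]_x (f \+ g)^\+ x) (\int[mu]_x (f \+ g)^\- x) (\int[mu]_x f^\+ x)
  (\int[mu]_x f^\- x) (\int[mu]_x g^\+ x) (\int[mu]_x g^\- x).
move=> [a| |] [b| |] [c| |] [e| |] [u| |] [v| |] //= _ _ _ _ _ _ _ _ _.
by rewrite -?EFinN -!EFinD => -[] E; congr EFin; lra.
Qed.

Lemma qintegrableZ mu (k : R) f : (0 <= k)%R -> qintegrable mu f ->
  qintegrable mu (fun x => k%:E * f x).
Proof.
move=> k0 [mf fy If]; split; first exact: measurable_funeM.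
  by move=> x; case: (f x) (fy x) => [r| |] // _; [rewrite -EFinM ltry|
    move: k0; rewrite le_eqVlt => /predU1P[<-|k0]; rewrite ?mul0e ?ltry// gt0_muleNy].
rewrite ge0_funeposM// ge0_integralZl_EFin//; last exact: measurable_funepos.
by apply: lte_mul_pinfty.
Qed.

Lemma integral_qintegrableZ mu (k : R) f : (0 <= k)%R -> qintegrable mu f ->
  \int[mu]_x (k%:E * f x) = k%:E * \int[mu]_x f x.
Proof.
move=> k0 [mf fy If]; rewrite integralE [in RHS]integralE.
rewrite ge0_funeposM// ge0_funenegM//.
rewrite !ge0_integralZl_EFin//; try exact: measurable_funepos;
  try exact: measurable_funeneg.
have pfin : \int[mu]_x f^\+ x \is a fin_num by rewrite ge0_fin_numE// integral_ge0.
by apply/esym/muleBr => //; exact: fin_num_adde_defr.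
Qed.

(** Fatou's lemma for the nonnegative functions h - F n. A constant [c] below all integrals takes
    the place of a limit superior: this is sequential upper semicontinuity in the form used for the
    maxima. *)
Lemma reverse_fatou mu (F : nat -> T -> \bar R) f (h : T -> R) (c : \bar R) :
  (forall n, measurable_fun setT (F n)) -> measurable_fun setT f ->
  qintegrable mu (EFin \o h) -> (forall x, (0 <= h x)%R) ->
  (forall n x, F n x <= (h x)%:E) ->
  (forall x, F ^~ x @ \oo --> f x) ->
  (forall n, c <= \int[mu]_x F n x) -> c <= \int[mu]_x f x.
Proof.
move=> mF mf qh h0 Fh Ff cF.
have [mh hy Ih] := qh.
have Ih' := qintegrable_lty qh.
have mFh n : measurable_fun setT (fun x => (h x)%:E - F n x) by exact: emeasurable_funB.
have mfh : measurable_fun setT (fun x => (h x)%:E - f x) by exact: emeasurable_funB.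
have fh x : f x <= (h x)%:E.
  by rewrite -(cvg_lim _ (Ff x))//; apply: lime_le;
    [apply/cvg_ex; exists (f x); exact: Ff|exact: nearW].
have hB_ge0 x a : a <= (h x)%:E -> 0 <= (h x)%:E - a by rewrite sube_ge0 ?orbT.
(* Recovers the integral of [g] from that of h - g; the integral of [h] is finite, so nothing is
   lost when that of [g] is -oo. *)
have split g : measurable_fun setT g -> (forall x, g x <= (h x)%:E) ->
    \int[mu]_x g x = \int[mu]_x (h x)%:E - \int[mu]_x ((h x)%:E - g x).
  move=> mg gh; have g0 x : 0 <= (h x)%:E - g x by exact: hB_ge0.
  have mhg : measurable_fun setT (fun x => (h x)%:E - g x) by exact: emeasurable_funB.
  rewrite -integral_ge0N// -integral_qintegrableD//.
    apply: eq_integral => x _; move: (gh x); case: (g x) => [r _|//|_]/=.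
      by rewrite -!EFinB; congr EFin; lra.
    by [].
  apply: (@qintegrable_le _ _ (EFin \o h)) => //.
    exact: measurableT_comp.
  by move=> x /=; apply: (@le_trans _ _ 0); rewrite ?lee_fin// leeNl oppe0.
have hfin : \int[mu]_x (h x)%:E \is a fin_num.
  by rewrite ge0_fin_numE// integral_ge0// => x _; rewrite lee_fin.
rewrite (split f)//.
have : \int[mu]_x ((h x)%:E - f x) <= \int[mu]_x (h x)%:E - c.
  apply: (@le_trans _ _ (limn_einf (fun n => \int[mu]_x ((h x)%:E - F n x)))).
    rewrite [leLHS](_ : _ = \int[mu]_x limn_einf (fun n => (h x)%:E - F n x)).
      by apply: fatou => // n x _; exact: hB_ge0.
    apply: eq_integral => x _; apply/esym.
    have := @cvg_limn_einf_sup _ (fun n => (h x)%:E - F n x) ((h x)%:E - f x).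
    by case=> //; apply: cvgeB => //; exact: cvg_cst.
  rewrite limn_einf_lim; apply: lime_le; first exact: is_cvg_einfs.
  apply: nearW => n.
  apply: (@le_trans _ _ (\int[mu]_x ((h x)%:E - F n x))).
    by apply: ereal_inf_lbound; exists n => /=.
  have := cF n; rewrite (split (F n))// => cn.
  move: (hfin) cn; case: (\int[mu]_x (h x)%:E) => // r _.
  have : 0 <= \int[mu]_x ((h x)%:E - F n x) by apply: integral_ge0 => x _; exact: hB_ge0.
  case: (\int[mu]_x ((h x)%:E - F n x)) => [s| |] //; case: c {cF} => [t| |]//=.
    by rewrite -!EFinB !lee_fin; lra.
  by move=> _ _; exact: leey.
move: hfin; case: (\int[mu]_x (h x)%:E) => // r _.
have : 0 <= \int[mu]_x ((h x)%:E - f x) by apply: integral_ge0 => x _; exact: hB_ge0.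
case: (\int[mu]_x ((h x)%:E - f x)) => [s| |] //; case: c {cF} => [t| |]//=.
  by rewrite -!EFinB !lee_fin; lra.
by move=> *; exact: leNye.
Qed.

End QuasiIntegral.

Section QuasiFubini.
Local Open Scope ereal_scope.
Context d1 d2 (T1 : measurableType d1) (T2 : measurableType d2) (R : realType).
Variables (m1 : probability T1 R) (m2 : probability T2 R).

(** Tonelli applies to the positive and negative parts separately. The bound on every section makes
    the inner integral of the positive part finite, so the two outer integrals can be recombined
    under one sign. *)
Lemma qintegrable_fubini (f : T1 * T2 -> \bar R) :
  qintegrable (m1 \x m2) f ->
  (forall x, \int[m2]_y f^\+ (x, y) < +oo) ->
  \int[m1 \x m2]_z f z = \int[m1]_x \int[m2]_y f (x, y).
Proof.
move=> [mf fy If] Ifx.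
have mfp := measurable_funepos mf; have mfn := measurable_funeneg mf.
rewrite integralE !fubini_tonelli1//.
pose p x := \int[m2]_y f^\+ (x, y); pose n x := \int[m2]_y f^\- (x, y).
have mp : measurable_fun setT p by exact: (measurable_fun_fubini_tonelli_F f^\+).
have mn : measurable_fun setT n by exact: (measurable_fun_fubini_tonelli_F f^\-).
have p0 x : 0 <= p x by exact: integral_ge0.
have n0 x : 0 <= n x by exact: integral_ge0.
rewrite -[X in _ - X]/(\int[m1]_x n x) -[X in X - _]/(\int[m1]_x p x).
rewrite -integral_ge0N// -integral_qintegrableD//; first last.
- apply: (@qintegrable_le _ _ _ _ _ (cst 0)).
  + exact: measurableT_comp.
  + exact: qintegrable_cst.
  + by move=> x; rewrite leeNl oppe0.
- apply: qintegrable_ge0 => //.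
  by move: If; rewrite fubini_tonelli1.
apply: eq_integral => x _; rewrite [RHS]integralE; congr (_ - _).
  by apply: eq_integral => y _; rewrite !funeposE.
by apply: eq_integral => y _; rewrite !funenegE.
Qed.

End QuasiFubini.

(** * The logarithm with value -oo at 0 *)

Section Lne.
Local Open Scope ereal_scope.
Context {R : realType}.

Lemma lne_lty (r : R) : lne r%:E < +oo.
Proof. by rewrite /=; case: ifP => // _; rewrite ltry. Qed.

Lemma le_lne (a b : \bar R) : a <= b -> lne a <= lne b.
Proof.
move=> ab; have [a0|a0] := leP a 0; first by rewrite le0_lneNy// leNye.
by rewrite lee_lne// in_itv/= leey ltW// (lt_le_trans a0).
Qed.

(** The value -oo is absorbing for addition below +oo, so the product rule survives a zero
    factor. *)
Lemma lneM_ge0 (a b : R) : (0 <= a)%R -> (0 <= b)%R ->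
  lne (a * b)%:E = lne a%:E + lne b%:E.
Proof.
rewrite le_eqVlt => /predU1P[<- _|a0]; first by rewrite mul0r /= lexx addNye.
rewrite le_eqVlt => /predU1P[<-|b0]; first by rewrite mulr0 /= lexx addeNy.
by rewrite !lne_EFin ?mulr_gt0// lnM.
Qed.

Lemma lne_sqr (a : R) : (0 <= a)%R -> lne (a ^+ 2)%:E = 2%:E * lne a%:E.
Proof.
move=> a0; rewrite expr2 lneM_ge0//.
by rewrite -mule2n mule_natl.
Qed.

Lemma measurable_lne_EFin d (T : measurableType d) (f : T -> R) :
  measurable_fun setT f -> measurable_fun setT (fun x => lne (f x)%:E).
Proof.
move=> mf; rewrite /lne; apply: measurable_fun_ifT => //.
  exact: measurable_fun_ler.
exact/measurable_EFinP/(measurableT_comp (@measurable_ln R)).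
Qed.

(** Continuity extends to the limit 0, where the values tend to -oo; terms [u n] that are not
    positive already have the value -oo. *)
Lemma cvg_lne (u : R^nat) (l : R) : u @ \oo --> l ->
  (0 <= l)%R -> (fun n => lne (u n)%:E) @ \oo --> lne l%:E.
Proof.
move=> ul; rewrite le_eqVlt => /predU1P[l0|l0].
  rewrite -l0 /= lexx; apply/cvgeNyPle => A.
  have : \forall n \near \oo, (u n < expR A)%R.
    by apply: (cvgr_lt l) => //; rewrite -l0 expR_gt0.
  apply: filterS => n un; case: ifPn => [_|]; first by rewrite leNye.
  by rewrite -ltNge => u0; rewrite lee_fin -ler_expR lnK// ltW.
rewrite lne_EFin//.
have lnu : (fun n => ln (u n)) @ \oo --> ln l.
  by apply: continuous_cvg => //; exact: continuous_ln.
have : (fun n => (ln (u n))%:E) @ \oo --> (ln l)%:E by apply: cvg_EFin lnu; exact: nearW.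
apply: cvg_trans; apply: near_eq_cvg.
have : \forall n \near \oo, (0 < u n)%R by apply: (cvgr_gt l).
by apply: filterS => n un; rewrite lne_EFin.
Qed.

End Lne.

(** * Random matrices and laws of matrix sequences *)

Section RandomMatrix.
Context {disp : measure_display} {T : measurableType disp} {R : realType} {d : nat}.
Local Notation C := R[i].
Local Notation M := 'M[C]_d.
Implicit Types (A B : T -> M) (X : M) (z : T -> C).

Definition cmeasurable z :=
  measurable_fun setT (fun w => complex.Re (z w)) /\
  measurable_fun setT (fun w => complex.Im (z w)).

Lemma cmeasurable_cst (c : C) : cmeasurable (cst c).
Proof. by split. Qed.

Lemma cmeasurableD z1 z2 : cmeasurable z1 -> cmeasurable z2 ->
  cmeasurable (fun w => z1 w + z2 w).
Proof.
move=> [r1 i1] [r2 i2]; split.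
- under eq_fun do rewrite raddfD; exact: measurable_funD.
- under eq_fun do rewrite raddfD; exact: measurable_funD.
Qed.

Lemma cmeasurableM z1 z2 : cmeasurable z1 -> cmeasurable z2 ->
  cmeasurable (fun w => z1 w * z2 w).
Proof.
move=> [r1 i1] [r2 i2]; split.
- have -> : (fun w => complex.Re (z1 w * z2 w)) = (fun w =>
      complex.Re (z1 w) * complex.Re (z2 w) - complex.Im (z1 w) * complex.Im (z2 w)).
    by apply/funext => w; case: (z1 w) => ? ?; case: (z2 w).
  by apply: measurable_funB; exact: measurable_funM.
- have -> : (fun w => complex.Im (z1 w * z2 w)) = (fun w =>
      complex.Re (z1 w) * complex.Im (z2 w) + complex.Im (z1 w) * complex.Re (z2 w)).
    by apply/funext => w; case: (z1 w) => ? ?; case: (z2 w).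
  by apply: measurable_funD; exact: measurable_funM.
Qed.

Lemma cmeasurable_conj z : cmeasurable z -> cmeasurable (fun w => Num.conj (z w)).
Proof.
move=> [rz iz]; split.
- have -> // : (fun w => complex.Re (Num.conj (z w))) = (fun w => complex.Re (z w)).
  by apply/funext => w; case: (z w).
- have -> : (fun w => complex.Im (Num.conj (z w))) = (fun w => - complex.Im (z w)).
    by apply/funext => w; case: (z w).
  exact: measurableT_comp.
Qed.

Lemma cmeasurable_sum (I : Type) (s : seq I) (z : I -> T -> C) :
  (forall i, cmeasurable (z i)) -> cmeasurable (fun w => \sum_(i <- s) z i w).
Proof.
move=> mz; elim: s => [|i s IH].
  by under eq_fun do rewrite big_nil; exact: cmeasurable_cst.
by under eq_fun do rewrite big_cons; exact: cmeasurableD.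
Qed.

Lemma random_matrixP A :
  random_matrix A <-> forall i j, cmeasurable (fun w => A w i j).
Proof.
split=> [mA i j|mA B].
  split=> _ B mB; rewrite setTI.
  - apply: (mA ((fun X => complex.Re (X i j)) @^-1` B)); apply: sub_sigma_algebra.
    by exists i, j, B; split=> //; left.
  - apply: (mA ((fun X => complex.Im (X i j)) @^-1` B)); apply: sub_sigma_algebra.
    by exists i, j, B; split=> //; right.
(* The sets with measurable preimage form a sigma-algebra, so it is enough to treat the
   generators. *)
suff : (mx_borel : set (set M)) `<=` [set E | measurable (A @^-1` E)] by exact.
apply: smallest_sub.
  split=> [|E /= mE|F /= mF].
  - by rewrite /= preimage_set0.
  - by rewrite setTD preimage_setC; exact: measurableC.
  - by rewrite preimage_bigcup; exact: bigcup_measurable.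
move=> E [i [j [D [mD [->|->]]]]] /=; have [rA iA] := mA i j.
- by rewrite -comp_preimage -[X in measurable X]setTI; exact: rA.
- by rewrite -comp_preimage -[X in measurable X]setTI; exact: iA.
Qed.

Lemma random_matrix_cst X : random_matrix (cst X : T -> M).
Proof. by apply/random_matrixP => i j; exact: cmeasurable_cst. Qed.

Lemma random_matrixM A B : random_matrix A -> random_matrix B ->
  random_matrix (fun w => A w *m B w).
Proof.
move=> /random_matrixP mA /random_matrixP mB; apply/random_matrixP => i j.
by under eq_fun do rewrite mxE; apply: cmeasurable_sum => k; exact: cmeasurableM.
Qed.

Lemma random_matrix_adj A : random_matrix A -> random_matrix (fun w => (A w)^t*).
Proof.
move=> /random_matrixP mA; apply/random_matrixP => i j.
by under eq_fun do rewrite !mxE; exact: cmeasurable_conj.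
Qed.

Lemma measurable_Re_tr A : random_matrix A ->
  measurable_fun setT (fun w => complex.Re (\tr (A w))).
Proof.
move=> /random_matrixP mA.
by have [] : cmeasurable (fun w => \tr (A w)) by apply: cmeasurable_sum.
Qed.

Lemma measurable_trXAA B A : random_matrix B -> random_matrix A ->
  measurable_fun setT (fun w => trXAA (B w) (A w)).
Proof.
move=> mB mA; apply: measurable_Re_tr; apply: random_matrixM.
  exact: random_matrixM.
exact: random_matrix_adj.
Qed.

Lemma measurable_sigma_max A : (0 < d)%N -> random_matrix A ->
  measurable_fun setT (fun w => sigma_max (A w)).
Proof.
move=> d0 mA; apply: (measurability _ (RGenOInfty.measurableE R)).
move=> _ [_ [c ->] <-]; rewrite setTI.
have -> : (fun w => sigma_max (A w)) @^-1` `]c, +oo[ =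
    ~` [set w | sigma_max (A w) <= c].
  by apply/seteqP; split=> w /=; rewrite in_itv /= andbT ltNge => /negP.
apply: measurableC; have [c0|c0] := ltP c 0.
  have -> // : [set w | sigma_max (A w) <= c] = set0.
  by apply/seteqP; split=> // w /=; rewrite leNgt (lt_le_trans c0)// sigma_max_ge0.
have -> : [set w | sigma_max (A w) <= c] = \bigcap_k [set w |
    complex.Re (\tr (iter k (mulmx ((A w)^t* *m A w)) 1%:M)) <= d%:R * (c ^+ 2) ^+ k].
  apply/seteqP; split=> w /= Aw.
    by move=> k _ /=; apply: (sigma_max_leP d0 (A w) c0).1.
  by apply: (sigma_max_leP d0 (A w) c0).2 => k; exact: Aw.
apply: bigcapT_measurable => k; rewrite -[X in measurable X]setTI.
have mAk : random_matrix (fun w => iter k (mulmx ((A w)^t* *m A w)) 1%:M).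
  elim: k => [|k IH] /=; first exact: random_matrix_cst.
  by apply: random_matrixM => //; apply: random_matrixM => //; exact: random_matrix_adj.
have := measurable_Re_tr mAk measurableT (measurable_itv `]-oo, d%:R * (c ^+ 2) ^+ k]).
by congr measurable; congr (_ `&` _); apply/seteqP; split=> w /=; rewrite in_itv.
Qed.

Lemma random_matrix_comp disp' (T' : measurableType disp') (phi : T' -> T) A :
  measurable_fun setT phi -> random_matrix A -> random_matrix (A \o phi).
Proof.
by move=> mphi mA B /mA mAB; rewrite comp_preimage -[X in measurable X]setTI; exact: mphi.
Qed.

End RandomMatrix.

(* [g_sigma_algebraType] is a measurable type only over a pointed type. *)
HB.instance Definition _ (R : realType) := isPointed.Build R[i] 0.

(** * Laws of matrix sequences and resampling of one coordinate *)

Section MatrixSequences.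
Context {R : realType} {d : nat}.
Local Notation M := 'M[R[i]]_d.

Definition cylinder (n : nat) (B : nat -> set M) : set (nat -> M) :=
  [set x | forall i, (i < n)%N -> B i (x i)].

Definition cylinders : set (set (nat -> M)) :=
  [set E | exists n B, (forall i, mx_borel (B i)) /\ E = cylinder n B].

Definition mxseq := g_sigma_algebraType cylinders.

(** Presents [mx_borel] as the measurable sets of a generated sigma-algebra, which gives access to
    the general closure lemmas. *)
Lemma mx_borelE : exists G : set (set M),
  (mx_borel : set (set M)) = G.-sigma.-measurable.
Proof. by eexists; reflexivity. Qed.

Lemma mx_borelT : mx_borel (setT : set M).
Proof. by have [G ->] := mx_borelE; exact: measurableT. Qed.

Lemma mx_borelI (A B : set M) : mx_borel A -> mx_borel B -> mx_borel (A `&` B).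
Proof.
by have [G ->] := mx_borelE; exact: measurableI.
Qed.

(** Padding with the full set brings two cylinders to a common length; being a pi-system is what the
    uniqueness of measures requires. *)
Lemma cylinders_setI : setI_closed cylinders.
Proof.
move=> _ _ [n [A [mA ->]]] [m [B [mB ->]]].
exists (maxn n m), (fun i => (if (i < n)%N then A i else setT) `&`
                            (if (i < m)%N then B i else setT)); split.
  by move=> i; apply: mx_borelI; case: ifP => // _; exact: mx_borelT.
apply/seteqP; split=> [x [xA xB] i _|x xAB].
  by split; case: ifP => // ?; [exact: xA|exact: xB].
split=> i im.
  by have := xAB i; rewrite leq_max im => /(_ isT) [].
by have := xAB i; rewrite leq_max im orbT => /(_ isT) [].
Qed.

Lemma random_matrix_coord i : random_matrix (fun x : mxseq => x i).
Proof.
move=> B mB; apply: sub_sigma_algebra.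
exists i.+1, (fun j => if j == i then B else setT); split.
  by move=> j; case: ifP => // _; exact: mx_borelT.
apply/seteqP; split=> [x xB j _|x xB] /=; first by case: ifP => // /eqP ->.
by have := xB i (ltnSn i); rewrite eqxx.
Qed.

Lemma measurable_mxseq disp (T : measurableType disp) (X : T -> mxseq) :
  (forall i, random_matrix (fun w => X w i)) -> measurable_fun setT X.
Proof.
move=> mX; apply: (@measurability _ _ T mxseq setT X cylinders) => //.
move=> _ [_ [n [B [mB ->]]] <-]; rewrite setTI.
have -> : X @^-1` cylinder n B = \bigcap_(i in `I_n) ((fun w => X w i) @^-1` B i).
  by [].
by apply: fin_bigcap_measurable => [|i _]; [exact: finite_II|exact: mX].
Qed.

Section Law.
Context disp (T : measurableType disp) (P : probability T R).
Context disp' (T' : measurableType disp') (P' : probability T' R).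
Variables (X : T -> mxseq) (X' : T' -> mxseq).
Hypothesis mX : forall i, random_matrix (fun w => X w i).
Hypothesis mX' : forall i, random_matrix (fun w => X' w i).
Hypothesis XX' : forall n B, (forall i, mx_borel (B i)) ->
  P (X @^-1` cylinder n B) = P' (X' @^-1` cylinder n B).

Let MX := measurable_mxseq mX.
Let MX' := measurable_mxseq mX'.

Lemma eq_law (E : set mxseq) : measurable E ->
  pushforward P X E = pushforward P' X' E.
Proof.
pose m1 : {measure set mxseq -> \bar R} := pushforward P X.
pose m2 : {measure set mxseq -> \bar R} := pushforward P' X'.
move=> mE; rewrite -[LHS]/(m1 MX E) -[RHS]/(m2 MX' E).
apply: (@measure_unique _ R mxseq cylinders (fun=> setT)) => //.
- exact: cylinders_setI.
- move=> _; exists 0%N, (fun=> setT); split; first by move=> _; exact: mx_borelT.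
  by apply/seteqP; split.
- by rewrite bigcup_const.
- by move=> _ [n [B [mB ->]]]; exact: XX'.
- by move=> _; rewrite /m1 /= /pushforward preimage_setT probability_setT ltry.
Qed.

(** Splitting into positive and negative parts reduces to nonnegative functions, so the identity
    covers infinite integrals too. *)
Lemma eq_law_integral (f : mxseq -> \bar R) : measurable_fun setT f ->
  (\int[P]_w f (X w) = \int[P']_w f (X' w))%E.
Proof.
have ge0 (g : mxseq -> \bar R) : measurable_fun setT g -> (forall x, 0 <= g x)%E ->
    (\int[P]_w g (X w) = \int[P']_w g (X' w))%E.
  move=> mg g0.
  have := ge0_integral_pushforward MX P measurableT mg (fun x _ => g0 x).
  have := ge0_integral_pushforward MX' P' measurableT mg (fun x _ => g0 x).
  rewrite !preimage_setT => <- <-.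
  by apply: eq_measure_integral => E mE _; exact: eq_law.
move=> mf; rewrite integralE [RHS]integralE; congr (_ - _)%E.
  rewrite (funepos_comp f X) (funepos_comp f X'); apply: ge0 => //.
  exact: measurable_funepos.
rewrite (funeneg_comp f X) (funeneg_comp f X'); apply: ge0 => //.
exact: measurable_funeneg.
Qed.

Lemma eq_law_qintegrable (f : mxseq -> \bar R) : measurable_fun setT f ->
  qintegrable P' (f \o X') -> (forall w, f (X w) < +oo)%E -> qintegrable P (f \o X).
Proof.
move=> mf [_ _ If] fy; split=> //; first exact: measurableT_comp.
rewrite funepos_comp (eq_law_integral (measurable_funepos mf)).
by rewrite funepos_comp in If.
Qed.

End Law.

Section IID.
Context disp (T : measurableType disp) (P : probability T R) (L : nat -> T -> M).
Hypotheses (L_meas : forall i, random_matrix (L i)) (L_indep : independent_matrices P L)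
  (L_id : identically_distributed P L).

(** The right side does not involve [m]: the shifted sequence has the law of the original one, which
    is the source of subadditivity. *)
Lemma iid_cylinder (m n : nat) (B : nat -> set M) : (forall i, mx_borel (B i)) ->
  (P ((fun w i => L (m + i) w) @^-1` cylinder n B) =
   \prod_(0 <= i < n) P (L 0%N @^-1` B i))%E.
Proof.
move=> mB; pose s := iota m n; pose J : {fset nat} := [fset x in s]%fset.
have -> : (fun w i => L (m + i) w) @^-1` cylinder n B =
    \bigcap_(i in [set` J]) (L i @^-1` B (i - m)%N).
  apply/seteqP; split=> w Bw i /=.
    rewrite in_fset mem_iota => /andP[mi imn].
    by have := Bw (i - m)%N; rewrite /= subnKC//; apply; rewrite ltn_subLR.
  move=> i_n; have := Bw (m + i)%N; rewrite /= addKn; apply.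
  by rewrite in_fset mem_iota leq_addr ltn_add2l.
rewrite (L_indep J (B := fun i => B (i - m)%N))//.
rewrite (perm_big s); last first.
  apply: uniq_perm; rewrite ?fset_uniq ?iota_uniq// => i.
  by rewrite in_fset.
rewrite /s -[m in iota m n]addn0 iotaDl big_map /index_iota subn0.
by apply: eq_bigr => i _; rewrite addKn; exact: L_id.
Qed.

(* [L k] is replaced by an independent copy living on the second factor. *)
Definition resample (k : nat) (w : T * T) : mxseq :=
  fun i => if i == k then L 0%N w.2 else L i w.1.

Lemma random_matrix_resample k i : random_matrix (fun w => resample k w i).
Proof.
rewrite /resample; case: eqP => _.
  exact: (random_matrix_comp measurable_snd (L_meas 0%N)).
exact: (random_matrix_comp measurable_fst (L_meas i)).
Qed.

(** Both sides split off the factor P (L 0 in B k): on the left by the product formula, on the right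
    because [resample] puts index [k] on the second factor. What remains is the cylinder [B''],
    which leaves index [k] free. *)
Lemma resample_cylinder (k n : nat) (B : nat -> set M) : (forall i, mx_borel (B i)) ->
  P ((fun w i => L i w) @^-1` cylinder n B) =
  (P \x P)%E (resample k @^-1` cylinder n B).
Proof.
move=> mB; pose B' i := if (i < n)%N then B i else setT.
pose B'' i := if i == k then setT else B' i.
pose N := maxn n k.+1.
have mB' i : mx_borel (B' i) by rewrite /B'; case: ifP => // _; exact: mx_borelT.
have mB'' i : mx_borel (B'' i) by rewrite /B''; case: ifP => // _; exact: mx_borelT.
have BB' : cylinder n B = cylinder N B'.
  apply/seteqP; split=> x Bx i iN; rewrite /B'.
    by case: ifP => // /Bx.
  by have := Bx i; rewrite /B' iN leq_max iN; exact.
have kN : (k < N)%N by rewrite leq_max ltnSn orbT.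
rewrite BB'.
have -> : resample k @^-1` cylinder N B' =
    ((fun w i => L i w) @^-1` cylinder N B'') `*` (L 0%N @^-1` B' k).
  apply/seteqP; split=> -[w w'] /=.
    move=> Bx; split=> [i iN|]; rewrite /B''.
      by case: eqP => // /eqP/negbTE ik; have := Bx i iN; rewrite /resample ik.
    by have := Bx k kN; rewrite /resample eqxx.
  case=> Bx Bk i iN; rewrite /resample; case: eqP => [->//|/eqP/negbTE ik].
  by have := Bx i iN; rewrite /B'' ik.
have mX : measurable ((fun w i => L i w) @^-1` cylinder N B'').
  have := @measurable_mxseq _ _ (fun w i => L i w) L_meas measurableT (cylinder N B'').
  by rewrite setTI; apply; apply: sub_sigma_algebra; exists N, B''.
rewrite product_measure1E//; last exact: L_meas.
have iidE C : (forall i, mx_borel (C i)) -> P ((fun w i => L i w) @^-1` cylinder N C) =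
    (\prod_(i < N) P (L 0%N @^-1` C i))%E.
  move=> mC; have := iid_cylinder 0 N mC.
  by rewrite big_mkord.
rewrite (iidE _ mB') [X in _ = (X * _)%E](iidE _ mB'').
rewrite (bigD1 (Ordinal kN))// [in RHS](bigD1 (Ordinal kN))//=.
rewrite {1}/B'' eqxx preimage_setT probability_setT mul1e muleC; congr (_ * _)%E.
apply: eq_bigr => i ik; rewrite /B'' ifN//.
Qed.

End IID.
End MatrixSequences.

(** * Lyapunov exponents *)

Section Fekete.
Local Open Scope ereal_scope.
Context {R : realType}.
Variable a : nat -> \bar R.
Hypotheses (a0 : a 0%N = 0) (ay : forall n, a n < +oo)
  (aD : forall m n, a (m + n)%N <= a m + a n).
Let u n := (n%:R^-1)%:E * a n.
Let s := ereal_inf [set u n | n in [set n | (0 < n)%N]].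

(** The infimum [s] may be -oo, hence a real [c] above it. With u m < c and n = q m + r,
    subadditivity bounds a n by q copies of a m and one remainder, whose contribution is bounded in
    [n]. *)
Let fekete_near (c e : R) : s < c%:E -> (0 < e)%R -> \forall n \near \oo, u n <= (c + e)%:E.
Proof.
move=> /ereal_inf_lt [_ [m /= m0 <-] umc] e0.
have am : a m <= (m%:R * c)%:E.
  have mR : (0 < m%:R :> R)%R by rewrite ltr0n.
  by have := ltW umc; rewrite /u lee_pdivrMl// -EFinM.
have aq q : a (q * m)%N <= ((q * m)%:R * c)%:E.
  elim: q => [|q IH]; first by rewrite mul0n a0 mul0r.
  rewrite mulSn natrD mulrDl EFinD; apply: le_trans (aD _ _) _; exact: leeD.
(* A single real bound for all remainders; positive parts are summed because a r may be negative or
   -oo. *)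
pose b : R := (\sum_(r < m) Num.max (fine (a r)) 0)%R.
have ab r : (r < m)%N -> a r <= b%:E.
  move=> rm; apply: (@le_trans _ _ (Num.max (fine (a r)) 0)%:E).
    case: (a r) (ay r) => [x| |] // _; last exact: leNye.
    by rewrite lee_fin /= le_max lexx.
  rewrite lee_fin /b (bigD1 (Ordinal rm))//= lerDl sumr_ge0// => i _.
  by rewrite le_max lexx orbT.
(* The term m |c| pays for replacing q m c by n c; the threshold K / e then makes K / n at most
   e. *)
pose K : R := (m%:R * `|c| + b)%R.
have b0 : (0 <= b)%R by apply: sumr_ge0 => i _; rewrite le_max lexx orbT.
have K0 : (0 <= K)%R by rewrite addr_ge0// mulr_ge0.
exists (Num.bound (K / e)).+1 => // n /= Nn.
have n0 : (0 < n)%N by exact: leq_trans Nn.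
have nR : (0 < n%:R :> R)%R by rewrite ltr0n.
have an : a n <= (n%:R * c + K)%:E.
  rewrite [X in a X](divn_eq n m); apply: le_trans (aD _ _) _.
  apply: le_trans (leeD (aq _) (ab _ (ltn_pmod n m0))) _.
  rewrite -EFinD lee_fin {2}(divn_eq n m) natrD mulrDl /K addrA lerD2r.
  have : (- (n %% m)%:R * c <= m%:R * `|c|)%R.
    rewrite mulNr -mulrN; apply: (@le_trans _ _ ((n %% m)%:R * `|c|)%R).
      by rewrite ler_wpM2l// -normrN ler_norm.
    by rewrite ler_wpM2r// ler_nat ltnW// ltn_pmod.
  by rewrite mulNr; lra.
rewrite /u lee_pdivrMl//; apply: le_trans an _; rewrite -EFinM lee_fin mulrDr lerD2l.
rewrite -ler_pdivrMr//; apply: le_trans (ltW (archi_boundP _)) _.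
  by rewrite divr_ge0// ltW.
by rewrite ler_nat ltnW.
Qed.

Lemma cvg_fekete : u @ \oo --> s.
Proof.
have us n : (0 < n)%N -> s <= u n by move=> n0; apply: ereal_inf_lbound; exists n.
have s_lty : s < +oo.
  by apply: le_lt_trans (us 1%N isT) _; rewrite /u invr1 mul1e.
case: s s_lty us (@fekete_near) => [r| |] // _ us near_s.
  have unear (e : R) : (0 < e)%R -> \forall n \near \oo, u n <= (r + e)%:E.
    move=> e0; have e2 : (0 < e / 2)%R by rewrite divr_gt0.
    have := near_s (r + e / 2)%R (e / 2)%R _ e2; rewrite -addrA -splitr; apply.
    by rewrite lte_fin ltrDl.
  have fin_u : \forall n \near \oo, u n \is a fin_num.
    have := unear 1%R ltr01; have := nbhs_infty_gt 0%N; apply: filterS2 => n n0 un.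
    rewrite fin_numE; apply/andP; split.
      by rewrite -ltNye; exact: lt_le_trans (ltNyr r) (us n n0).
    by rewrite -ltey; exact: le_lt_trans un (ltry _).
  apply/fine_cvgP; split=> //; apply/cvgrPdist_le => e e0.
  have := unear e e0; have := nbhs_infty_gt 0%N; move: fin_u; apply: filterS3.
  move=> n + n0; have := us n n0 => /=; case: (u n) => [x| |] //=; rewrite !lee_fin => rx _ xe.
  by rewrite ler0_norm ?subr_le0//; lra.
(* Here the infimum is -oo; aiming at A - 1 leaves room for the slack 1. *)
apply/cvgeNyPle => A; have := near_s (A - 1)%R 1%R (ltNyr _) ltr01.
by rewrite subrK.
Qed.

End Fekete.

(** * Matrix products and the one-step logarithmic estimate *)

Section LyapunovBound.
Local Open Scope ereal_scope.
Context {R : realType} {d : nat} (d_gt0 : (0 < d)%N).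
Local Notation M := 'M[R[i]]_d.

Definition mxprod (n : nat) (x : nat -> M) : M := \big[mulmx/1%:M]_(i < n) x i.

Lemma mxprod0 x : mxprod 0 x = 1%:M.
Proof. by rewrite /mxprod big_ord0. Qed.

Lemma mxprodD m n x :
  mxprod (m + n) x = mxprod m x *m mxprod n (fun i => x (m + i)%N).
Proof.
elim: m x => [|m IH] x; first by rewrite mxprod0 mul1mx.
by rewrite addSn /mxprod !big_ord_recl -mulmxA; congr (_ *m _); exact: (IH (fun i => x i.+1)).
Qed.

Lemma mxprodS n x : mxprod n.+1 x = mxprod n x *m x n.
Proof. by rewrite -addn1 mxprodD {2}/mxprod big_ord_recl big_ord0 mulmx1 addn0. Qed.

Lemma eq_mxprod n x y : (forall i, (i < n)%N -> x i = y i) -> mxprod n x = mxprod n y.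
Proof. by move=> xy; apply: eq_bigr => i _; exact: xy. Qed.

Lemma random_matrix_mxprod disp (T : measurableType disp) n (X : T -> nat -> M) :
  (forall i, random_matrix (fun w => X w i)) -> random_matrix (fun w => mxprod n (X w)).
Proof.
move=> mX; elim: n => [|n IH].
  by under eq_fun do rewrite mxprod0; exact: random_matrix_cst.
by under eq_fun do rewrite mxprodS; exact: random_matrixM.
Qed.

Definition gram n x := (mxprod n x)^t* *m mxprod n x.

Lemma psd_gram n x : psd (gram n x).
Proof. exact: psd_gram_adj. Qed.

Definition tr_gram n x : R := complex.Re (\tr (gram n x)).

Lemma tr_gram0 x : tr_gram 0 x = d%:R.
Proof.
rewrite /tr_gram /gram mxprod0 mulmx1 trmx1 map_mx1 mxtrace1.
by rewrite -(rmorph_nat (real_complex R)).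
Qed.

Lemma tr_gramS n x : tr_gram n.+1 x = trXAA (gram n x) (x n).
Proof.
rewrite /tr_gram /trXAA /gram mxprodS; congr complex.Re.
by rewrite adjmxM mxtrace_mulC !mulmxA mxtrace_mulC !mulmxA.
Qed.

Lemma sigma_max_mxprod_le n x : (sigma_max (mxprod n x) ^+ 2 <= tr_gram n x)%R.
Proof. by rewrite /tr_gram /gram mxtrace_mulC; exact: sigma_max_sqr_le_tr. Qed.

Section Prob.
Local Open Scope ereal_scope.
Context disp (T : measurableType disp) (P : probability T R) (L : nat -> T -> M).
Hypotheses (L_meas : forall i, random_matrix (L i)) (L_indep : independent_matrices P L)
  (L_id : identically_distributed P L) (L_log : ex_log_plus_sigma P (L 0%N) < +oo).

Definition log_plus_sigma (w : T) : \bar R := maxe (lne (sigma_max (L 0%N w))%:E) 0.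

Lemma log_plus_sigma_ge0 w : 0 <= log_plus_sigma w.
Proof. by rewrite /log_plus_sigma le_max lexx orbT. Qed.

Lemma log_plus_sigma_lty w : log_plus_sigma w < +oo.
Proof. by rewrite /log_plus_sigma gt_max lne_lty ltry. Qed.

Lemma qintegrable_log_plus_sigma : qintegrable P log_plus_sigma.
Proof.
apply: qintegrable_ge0; first last.
- exact: L_log.
- exact: log_plus_sigma_ge0.
- exact: log_plus_sigma_lty.
apply: measurable_maxe => //; apply: measurable_lne_EFin.
exact: measurable_sigma_max.
Qed.

(** An integrable majorant for the logarithmic functionals, uniform over density matrices since
    their trace term vanishes; it also controls the case of trace 0. *)
Lemma lne_trXAA_le X w : psd X ->
  lne (trXAA X (L 0%N w))%:E <=
  lne (complex.Re (\tr X))%:E + 2%:E * log_plus_sigma w.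
Proof.
move=> Xp; have t0 : (0 <= complex.Re (\tr X))%R := Re_le (psd_trace_ge0 Xp).
apply: (@le_trans _ _ (lne (sigma_max (L 0%N w) ^+ 2 * complex.Re (\tr X))%:E)).
  by apply: le_lne; rewrite lee_fin; exact: trXAA_le.
rewrite lneM_ge0 ?exprn_ge0 ?sigma_max_ge0// addeC leeD2l// lne_sqr ?sigma_max_ge0//.
by apply: lee_wpmul2l; rewrite ?lee_fin// /log_plus_sigma le_max lexx.
Qed.

Lemma qintegrable_lne_trXAA X : psd X ->
  qintegrable P (fun w => lne (trXAA X (L 0%N w))%:E).
Proof.
move=> Xp; apply: (@qintegrable_le _ _ _ _ _
    (cst (lne (complex.Re (\tr X))%:E) \+ (fun w => 2%:E * log_plus_sigma w))).
- apply: measurable_lne_EFin; apply: measurable_trXAA => //; exact: random_matrix_cst.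
- apply: qintegrableD; first exact/qintegrable_cst/lne_lty.
  by apply: qintegrableZ => //; exact: qintegrable_log_plus_sigma.
- by move=> w; exact: lne_trXAA_le.
Qed.

Lemma ex_log_tr_psd_le (v : \bar R) X :
  (forall Y, density Y -> ex_log_tr P (L 0%N) Y <= v) -> psd X ->
  \int[P]_w lne (trXAA X (L 0%N w))%:E <= lne (complex.Re (\tr X))%:E + v.
Proof.
move=> vP Xp; set t := complex.Re (\tr X).
have : (0 <= t)%R := Re_le (psd_trace_ge0 Xp).
rewrite le_eqVlt => /predU1P[t0|t0].
  (* A psd matrix of trace 0 cannot be rescaled to a density matrix; the majorant then forces the
     integrand to be -oo everywhere. *)
  rewrite -t0 /= lexx addNye leeNy_eq.
  rewrite (eq_integral (cst -oo)); first by rewrite integral_cst_probability.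
  move=> w _ /=; have := lne_trXAA_le w Xp; rewrite -/t -t0 /= lexx addNye leeNy_eq.
  by move=> /eqP.
have XY : X = t%:C *: (t^-1%:C *: X).
  by rewrite scalerA -rmorphM mulfV ?gt_eqF// scale1r.
have Yd := psd_normalize Xp t0; rewrite -/t in Yd.
have Yp : psd (t^-1%:C *: X) by case: Yd.
rewrite {1}XY (eq_integral (fun w => cst (lne t%:E) w + lne (trXAA (t^-1%:C *: X) (L 0%N w))%:E)).
  rewrite integral_qintegrableD.
  - by rewrite integral_cst_probability leeD2l//; exact: vP.
  - exact/qintegrable_cst/lne_lty.
  - exact: qintegrable_lne_trXAA.
by move=> w _; rewrite trXAAZ lneM_ge0 ?(ltW t0)//; exact: trXAA_ge0.
Qed.

End Prob.
End LyapunovBound.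

Section QuasiProduct.
Local Open Scope ereal_scope.
Context d1 d2 (T1 : measurableType d1) (T2 : measurableType d2) (R : realType).
Variables (m1 : probability T1 R) (m2 : probability T2 R).

Lemma measurable_partial_integral (f : T1 * T2 -> \bar R) : measurable_fun setT f ->
  measurable_fun setT (fun x => \int[m2]_y f (x, y)).
Proof.
move=> mf.
have -> : (fun x => \int[m2]_y f (x, y)) =
    (fun x => \int[m2]_y f^\+ (x, y) - \int[m2]_y f^\- (x, y)).
  apply/funext => x; rewrite integralE; congr (_ - _).
    by apply: eq_integral => y _; rewrite !funeposE.
  by apply: eq_integral => y _; rewrite !funenegE.
apply: emeasurable_funB.
- exact: (measurable_fun_fubini_tonelli_F f^\+ (measurable_funepos mf)).
- exact: (measurable_fun_fubini_tonelli_F f^\- (measurable_funeneg mf)).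
Qed.

Lemma qintegrable_fst (f : T1 -> \bar R) : qintegrable m1 f ->
  qintegrable (m1 \x m2) (f \o fst).
Proof.
move=> [mf fy If]; have mf1 : measurable_fun setT (f \o (@fst T1 T2)).
  exact: measurableT_comp measurable_fst.
split=> [//|x|]; first exact: fy.
rewrite fubini_tonelli1//; last exact: measurable_funepos.
rewrite (eq_integral f^\+)// => x _; rewrite /fubini_F.
rewrite (eq_integral (cst (f^\+ x))); last by move=> y _; rewrite !funeposE.
exact: integral_cst_probability.
Qed.

Lemma qintegrable_snd (f : T2 -> \bar R) : qintegrable m2 f ->
  qintegrable (m1 \x m2) (f \o snd).
Proof.
move=> [mf fy If]; have mf2 : measurable_fun setT (f \o (@snd T1 T2)).
  exact: measurableT_comp measurable_snd.
split=> [//|x|]; first exact: fy.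
rewrite fubini_tonelli2//; last exact: measurable_funepos.
rewrite (eq_integral f^\+)// => x _; rewrite /fubini_G.
rewrite (eq_integral (cst (f^\+ x))); last by move=> y _; rewrite !funeposE.
exact: integral_cst_probability.
Qed.

End QuasiProduct.

Section Lyapunov.
Local Open Scope ereal_scope.
Context {R : realType} {d : nat} (d_gt0 : (0 < d)%N).
Local Notation M := 'M[R[i]]_d.
Context disp (T : measurableType disp) (P : probability T R) (L : nat -> T -> M).
Hypotheses (L_meas : forall i, random_matrix (L i)) (L_indep : independent_matrices P L)
  (L_id : identically_distributed P L) (L_log : ex_log_plus_sigma P (L 0%N) < +oo).

Let Lseq (w : T) : mxseq := fun i => L i w.

Let random_matrix_mxseq_prod n : random_matrix (fun x : @mxseq R d => mxprod n x).
Proof. exact: (@random_matrix_mxprod _ _ _ (@mxseq R d) n id random_matrix_coord). Qed.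

Lemma measurable_lne_tr_gram n :
  measurable_fun setT (fun x : @mxseq R d => lne (tr_gram n x : R)%:E).
Proof.
apply: measurable_lne_EFin; apply: measurable_Re_tr.
by apply: random_matrixM => //; exact: random_matrix_adj.
Qed.

Lemma measurable_lne_sigma_mxprod n :
  measurable_fun setT (fun x : @mxseq R d => lne (sigma_max (mxprod n x) : R)%:E).
Proof.
apply: measurable_lne_EFin; apply: measurable_sigma_max => //.
Qed.

(** Any upper bound [v] is allowed, so that a crude one can supply quasi-integrability before the
    sharp one is used. Quasi-integrability belongs to the induction because each step adds integrals
    and exchanges their order. *)
Lemma ex_lne_tr_gram_le (v : \bar R) n : v < +oo ->
  (forall Y, density Y -> ex_log_tr P (L 0%N) Y <= v) ->
  qintegrable P (fun w => lne (tr_gram n (Lseq w))%:E) /\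
  \int[P]_w lne (tr_gram n (Lseq w))%:E <= lne (d%:R : R)%:E + n%:R%:E * v.
Proof.
move=> vy vP; elim: n => [|n [qn IH]].
  have -> : (fun w => lne (tr_gram 0 (Lseq w))%:E) = cst (lne (d%:R : R)%:E).
    by apply/funext => w; rewrite tr_gram0.
  split; first exact/qintegrable_cst/lne_lty.
  by rewrite integral_cst_probability mul0e adde0.
have mLs : measurable_fun setT Lseq by exact: measurable_mxseq.
have mY (n' : nat) : random_matrix (fun w => gram n' (Lseq w)).
  apply: random_matrixM; last exact: random_matrix_mxprod.
  exact/random_matrix_adj/random_matrix_mxprod.
(* The logarithm of the next trace, read on the resampled sequence: the first [n] matrices come from
   [w.1] and the matrix of index [n] from [w.2]. *)
pose F (w : T * T) := lne (trXAA (gram n (Lseq w.1)) (L 0%N w.2))%:E.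
have FE : F = (fun x : @mxseq R d => lne (tr_gram n.+1 x : R)%:E) \o resample L n.
  have E w : gram n (resample L n w) = gram n (Lseq w.1).
    rewrite /gram (@eq_mxprod R d n _ (Lseq w.1))// => i lt_in.
    by rewrite /resample ltn_eqF.
  have E' w : resample L n w n = L 0%N w.2 by rewrite /resample eqxx.
  by apply/funext => w; rewrite -[RHS]/(lne (tr_gram n.+1 (resample L n w))%:E) tr_gramS E E'.
have mres : measurable_fun setT (resample L n).
  by apply: measurable_mxseq => i; exact: random_matrix_resample.
have mF : measurable_fun setT F.
  by rewrite FE; apply: measurableT_comp => //; exact: measurable_lne_tr_gram.
have qlog := qintegrable_log_plus_sigma d_gt0 L_meas L_log.
have q2log := qintegrableZ (ler0n R 2) qlog.
have FH w w' : F (w, w') <= lne (tr_gram n (Lseq w))%:E + 2%:E * log_plus_sigma L w'.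
  exact: lne_trXAA_le (psd_gram _ _).
have qF : qintegrable (P \x P) F.
  apply: (@qintegrable_le _ _ _ _ _
    (((fun w => lne (tr_gram n (Lseq w))%:E) \o fst) \+
     ((fun w => 2%:E * log_plus_sigma L w) \o snd))) => //.
    by apply: qintegrableD; [exact: qintegrable_fst|exact: qintegrable_snd].
  by move=> [w w']; exact: FH.
have qFw w : qintegrable P (fun w' => F (w, w')).
  exact: (qintegrable_lne_trXAA d_gt0 L_meas L_log (psd_gram n (Lseq w))).
have IF : \int[P \x P]_z F z <= \int[P]_w lne (tr_gram n (Lseq w))%:E + v.
  rewrite qintegrable_fubini//; last first.
    by move=> w; have [_ _] := qFw w; rewrite funepos_comp.
  apply: (@le_trans _ _ (\int[P]_w (lne (tr_gram n (Lseq w))%:E + cst v w))).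
    apply: le_integral_qintegrable.
    - exact: measurable_partial_integral.
    - by apply: emeasurable_funD => //; case: qn.
    - move=> w; exact: (ex_log_tr_psd_le d_gt0 L_meas L_log vP (psd_gram n (Lseq w))).
  rewrite integral_qintegrableD//; last exact: qintegrable_cst.
  by rewrite integral_cst_probability.
(* Returns from the product space to the original sequence, for the integral and for
   quasi-integrability. *)
have law := eq_law_integral (X := Lseq) (X' := resample L n) L_meas
  (random_matrix_resample L_meas n) (resample_cylinder L_meas L_indep L_id n).
have law' := eq_law_qintegrable (X := Lseq) (X' := resample L n) L_meas
  (random_matrix_resample L_meas n) (resample_cylinder L_meas L_indep L_id n).
split.
  apply: (law' _ (measurable_lne_tr_gram n.+1)) => [|w]; last exact: lne_lty.
  by rewrite -FE.
rewrite (law _ (measurable_lne_tr_gram n.+1)).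
rewrite -[leLHS]/(\int[P \x P]_z
  ((fun x : @mxseq R d => lne (tr_gram n.+1 x : R)%:E) \o resample L n) z) -FE.
apply: (le_trans IF); apply: le_trans (leeD2r v IH) _.
by rewrite -addeA leeD2l// -natr1 EFinD ge0_muleDl ?lee_fin// mul1e.
Qed.

End Lyapunov.

(** * Subadditivity, existence of the limit and its upper bound *)

Section LyapunovLimit.
Local Open Scope ereal_scope.
Context {R : realType} {d : nat} (d_gt0 : (0 < d)%N).
Local Notation M := 'M[R[i]]_d.
Context disp (T : measurableType disp) (P : probability T R) (L : nat -> T -> M).
Hypotheses (L_meas : forall i, random_matrix (L i)) (L_indep : independent_matrices P L)
  (L_id : identically_distributed P L) (L_log : ex_log_plus_sigma P (L 0%N) < +oo).

Let Lseq (w : T) : mxseq := fun i => L i w.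
Let a n := \int[P]_w lne (sigma_max (mxprod n (Lseq w)))%:E.

Lemma lne_trXAA_density_le X w : density X ->
  lne (trXAA X (L 0%N w))%:E <= 2%:E * log_plus_sigma L w.
Proof.
case=> Xp X1; apply: le_trans (lne_trXAA_le d_gt0 L w Xp) _.
by rewrite X1 -[complex.Re 1%R]/(1%R) lne1 add0e.
Qed.

Lemma ex_log_tr_le X : density X ->
  ex_log_tr P (L 0%N) X <= 2%:E * ex_log_plus_sigma P (L 0%N).
Proof.
move=> Xd; have [Xp _] := Xd; have q := qintegrable_log_plus_sigma d_gt0 L_meas L_log.
rewrite -[ex_log_plus_sigma _ _]/(\int[P]_w log_plus_sigma L w).
rewrite -integral_qintegrableZ//.
apply: le_integral_qintegrable.
- by have [] := qintegrable_lne_trXAA d_gt0 L_meas L_log Xp.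
- by have [] := qintegrableZ (ler0n R 2) q.
- by move=> w; exact: lne_trXAA_density_le.
Qed.

Lemma ex_log_tr_lty X : density X -> ex_log_tr P (L 0%N) X < +oo.
Proof.
move=> /ex_log_tr_le /le_lt_trans; apply; apply: lte_mul_pinfty => //.
Qed.

Let ub_lty : 2%:E * ex_log_plus_sigma P (L 0%N) < +oo.
Proof. exact: lte_mul_pinfty. Qed.

Let sigma_le n w : 2%:E * lne (sigma_max (mxprod n (Lseq w)))%:E <=
  lne (tr_gram n (Lseq w))%:E.
Proof.
by rewrite -lne_sqr ?sigma_max_ge0//; apply: le_lne; rewrite lee_fin; exact: sigma_max_mxprod_le.
Qed.

Let qintegrable_lne_tr_gram n : qintegrable P (fun w => lne (tr_gram n (Lseq w))%:E).
Proof. by have [] := ex_lne_tr_gram_le d_gt0 L_meas L_indep L_id L_log n ub_lty ex_log_tr_le. Qed.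

Let measurable_lne_sigma n :
  measurable_fun setT (fun w => lne (sigma_max (mxprod n (Lseq w)))%:E).
Proof.
apply: measurable_lne_EFin; apply: measurable_sigma_max => //.
exact: random_matrix_mxprod.
Qed.

Let qintegrable_lne_sigma n :
  qintegrable P (fun w => lne (sigma_max (mxprod n (Lseq w)))%:E).
Proof.
have q2 : qintegrable P (fun w => 2%:E * lne (sigma_max (mxprod n (Lseq w)))%:E).
  apply: qintegrable_le (qintegrable_lne_tr_gram n) _ => //.
  exact: measurable_funeM.
have i2 : (0 <= 2^-1 :> R)%R by rewrite invr_ge0.
have := qintegrableZ i2 q2; congr (qintegrable P); apply/funext => w.
by rewrite muleA -EFinM mulVf ?mul1e.
Qed.

Let a0 : a 0 = 0.
Proof.
rewrite /a (eq_integral (cst 0)); first exact: integral_cst_probability.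
by move=> w _; rewrite mxprod0 sigma_max1// lne1.
Qed.

Let a_lty n : a n < +oo.
Proof. exact/qintegrable_lty/qintegrable_lne_sigma. Qed.

Let a_shift m n : \int[P]_w lne (sigma_max (mxprod n (fun i => L (m + i)%N w)))%:E = a n.
Proof.
apply: (eq_law_integral (X := fun w i => L (m + i)%N w) (X' := Lseq) _ _ _
  (measurable_lne_sigma_mxprod d_gt0 n)) => // k B mB.
by rewrite (iid_cylinder L_indep L_id m k mB) -(iid_cylinder L_indep L_id 0 k mB).
Qed.

(** Submultiplicativity cuts the product at index [m]; the tail block has the same law as the first
    [n] matrices, so its expectation is a n. *)
Let aD m n : a (m + n) <= a m + a n.
Proof.
have qs : qintegrable P (fun w => lne (sigma_max (mxprod n (fun i => L (m + i)%N w)))%:E).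
  apply: (eq_law_qintegrable (X := fun w i => L (m + i)%N w) (X' := Lseq) _ _ _
    (measurable_lne_sigma_mxprod d_gt0 n) (qintegrable_lne_sigma n)) => // [k B mB|w].
    by rewrite (iid_cylinder L_indep L_id m k mB) -(iid_cylinder L_indep L_id 0 k mB).
  exact: lne_lty.
have E : \int[P]_w (lne (sigma_max (mxprod m (Lseq w)))%:E +
    lne (sigma_max (mxprod n (fun i => L (m + i)%N w)))%:E) = a m + a n.
  have E1 := integral_qintegrableD (qintegrable_lne_sigma m) qs.
  have E2 := a_shift m n.
  rewrite -E2.
  exact: E1.
rewrite -[leRHS]E.
have q := qintegrableD (qintegrable_lne_sigma m) qs.
apply: le_integral_qintegrable => //; first by case: q.
move=> w; rewrite -lneM_ge0 ?sigma_max_ge0//.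
by apply: le_lne; rewrite lee_fin mxprodD; exact: sigma_maxM.
Qed.

Let inf_a := ereal_inf [set (n%:R^-1)%:E * a n | n in [set n | (0 < n)%N]].

Let cvg_lyapunov : lyapunov_seq P L @ \oo --> inf_a.
Proof. exact: (cvg_fekete a0 a_lty aD). Qed.

Lemma is_cvg_lyapunov : cvgn (lyapunov_seq P L).
Proof. by apply/cvg_ex; exists inf_a. Qed.

Lemma lyapunov_max_le (v : \bar R) : v < +oo ->
  (forall Y, density Y -> ex_log_tr P (L 0%N) Y <= v) ->
  2%:E * lyapunov_max P L <= v.
Proof.
move=> vy vP; rewrite /lyapunov_max (cvg_lim _ cvg_lyapunov)//.
(* The limit is an infimum, so every single [n] bounds it; the error term comes from the trace d of
   the initial Gram matrix. *)
have bound n : (0 < n)%N -> 2%:E * inf_a <= (ln d%:R / n%:R)%:E + v.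
  move=> n0; have nR : (0 < n%:R :> R)%R by rewrite ltr0n.
  have sn : inf_a <= (n%:R^-1)%:E * a n by apply: ereal_inf_lbound; exists n.
  apply: (le_trans (lee_wpmul2l _ sn)); first by rewrite lee_fin.
  rewrite muleCA lee_pdivrMl// -integral_qintegrableZ//.
  have [qn Hn] := ex_lne_tr_gram_le d_gt0 L_meas L_indep L_id L_log n vy vP.
  apply: (@le_trans _ _ (\int[P]_w lne (tr_gram n (Lseq w))%:E)).
    by apply: le_integral_qintegrable => //; [exact: measurable_funeM|case: qn].
  apply: (le_trans Hn); rewrite lne_EFin ?ltr0n//.
  rewrite muleDr//.
  by rewrite -EFinM mulrCA mulfV ?mulr1// gt_eqF.
case: v vy {vP} bound => [r| |] // _ bound; last by have := bound 1%N isT; rewrite addeNy.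
apply/lee_addgt0Pr => e e0.
have ln0 : (0 <= ln (d%:R : R))%R by rewrite ln_ge0// ler1n.
pose n := (Num.bound (ln (d%:R : R) / e)).+1.
apply: (le_trans (bound n isT)); rewrite addeC leeD2l// lee_fin.
rewrite ler_pdivrMr ?ltr0n// mulrC -ler_pdivrMr//.
apply: le_trans (ltW (archi_boundP _)) _; first by rewrite divr_ge0// ltW.
by rewrite ler_nat.
Qed.

End LyapunovLimit.

(** * Compactness of the set of density matrices *)

Section EMax.
Context {R : realType} {V : pseudoMetricType R}.
Local Open Scope ereal_scope.

Lemma ereal_dense_real (x y : \bar R) : x < y -> exists c : R, x < c%:E < y.
Proof.
case: x y => [x| |] [y| |]// xy.
- rewrite lte_fin in xy; exists ((x + y) / 2)%R; rewrite !lte_fin.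
  by apply/andP; split; lra.
- by exists (x + 1)%R; rewrite lte_fin ltrDl ltr01 ltry.
- by exists (y - 1)%R; rewrite lte_fin ltrBlDr ltrDl ltr01 ltNyr.
- by exists 0%R; rewrite ltNyr ltry.
Qed.

(** The superlevel sets below the supremum generate a filter, which has a cluster point p in [K]. If
    f p were below the supremum, a real c strictly between and a sequence chosen from a superlevel
    set in shrinking balls around p would contradict [usc]. Sequences suffice here, which matches
    Fatou's lemma. *)
Lemma compact_seq_usc_max (K : set V) (f : V -> \bar R) : compact K -> K !=set0 ->
  (forall (u : nat -> V) p (c : \bar R), (forall n, K (u n)) -> K p -> u @ \oo --> p ->
     (forall n, c <= f (u n)) -> c <= f p) ->
  exists2 p, K p & forall q, K q -> f q <= f p.
Proof.
move=> cK [x0 Kx0] usc; set s := ereal_sup (f @` K).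
have fs q : K q -> f q <= s by move=> Kq; apply: ereal_sup_ubound; exists q.
(* With supremum -oo no level lies below it and the filter base would be empty; every point is then
   a maximizer. *)
have [sNy|sNy] := eqVneq s -oo.
  exists x0 => // q /fs; rewrite sNy leeNy_eq => /eqP ->; exact: leNye.
pose U c := [set q | K q /\ c <= f q].
pose F := filter_from [set c | c < s] U.
have FF : ProperFilter F.
  apply: filter_from_proper.
    apply: filter_from_filter; first by exists -oo => /=; rewrite ltNye.
    move=> c c' /= cs c's; exists (maxe c c'); first by rewrite /= gt_max cs.
    by move=> q [Kq]; rewrite ge_max => /andP[].
  by move=> c /= /ereal_sup_gt [_ [q Kq <-] cq]; exists q; split=> //; exact: ltW.
have FK : F K by exists -oo => [|q []//]; rewrite /= ltNye.
have [p [Kp clp]] := cK F FF FK.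
exists p => // q Kq; apply: le_trans (fs q Kq) _; rewrite leNgt; apply/negP => fps.
have [c /andP[fpc cs]] := ereal_dense_real fps.
have FU : F (U c%:E) by exists c%:E.
have /choice [u uP] : forall n : nat, exists v, U c%:E v /\ ball p (n.+1%:R^-1) v.
  move=> n; have [] := clp (U c%:E) (ball p (n.+1%:R^-1)) FU.
    by apply: nbhsx_ballx.
  by move=> v [Uv pv]; exists v.
have : c%:E <= f p.
  apply: (usc u) => //; try by move=> n; have [[]] := uP n.
  apply/cvg_ballP => e e0.
  near=> n; have [_] := uP n; apply: le_ball.
  by apply/ltW; near: n; exact: near_infty_natSinv_lt (PosNum e0).
by rewrite leNgt fpc.
Unshelve. all: by end_near. Qed.

End EMax.

Section RealCoordinates.
Context {R : realType} {d : nat}.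
Local Notation C := R[i].
Local Notation M := 'M[C]_d.
Implicit Types X : M.

Let I : finType := ('I_d * 'I_d * bool)%type.
Local Notation V := 'rV[R]_#|I|.

(* Compactness is only available for real row vectors, hence these coordinates. *)
Definition mxof (v : V) : M :=
  \matrix_(i, j) (v 0 (enum_rank ((i, j, false) : I)) +i* v 0 (enum_rank ((i, j, true) : I))).

Lemma mxof_surj X : exists v, mxof v = X.
Proof.
exists (\row_k let: (i, j, b) := enum_val k : I in
  if b then complex.Im (X i j) else complex.Re (X i j)).
by apply/matrixP => i j; rewrite !mxE !enum_rankK; case: (X i j).
Qed.

Definition ccontinuous (z : V -> C) :=
  continuous (fun v => complex.Re (z v)) /\ continuous (fun v => complex.Im (z v)).

Lemma ccontinuous_cst c : ccontinuous (fun=> c).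
Proof. by split; exact: cst_continuous. Qed.

Lemma ccontinuousD z1 z2 : ccontinuous z1 -> ccontinuous z2 ->
  ccontinuous (fun v => z1 v + z2 v).
Proof.
move=> [r1 i1] [r2 i2]; split.
- have -> : (fun v => complex.Re (z1 v + z2 v)) =
      (fun v => complex.Re (z1 v)) \+ (fun v => complex.Re (z2 v)).
    by apply/funext => w; rewrite raddfD.
  by move=> v; exact: cvgD (r1 v) (r2 v).
- have -> : (fun v => complex.Im (z1 v + z2 v)) =
      (fun v => complex.Im (z1 v)) \+ (fun v => complex.Im (z2 v)).
    by apply/funext => w; rewrite raddfD.
  by move=> v; exact: cvgD (i1 v) (i2 v).
Qed.

Lemma ccontinuousM z1 z2 : ccontinuous z1 -> ccontinuous z2 ->
  ccontinuous (fun v => z1 v * z2 v).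
Proof.
move=> [r1 i1] [r2 i2]; split.
- have -> : (fun v => complex.Re (z1 v * z2 v)) = (fun v =>
      complex.Re (z1 v) * complex.Re (z2 v) - complex.Im (z1 v) * complex.Im (z2 v)).
    by apply/funext => w; case: (z1 w) => ? ?; case: (z2 w).
  by move=> v; exact: cvgB (cvgM (r1 v) (r2 v)) (cvgM (i1 v) (i2 v)).
- have -> : (fun v => complex.Im (z1 v * z2 v)) = (fun v =>
      complex.Re (z1 v) * complex.Im (z2 v) + complex.Im (z1 v) * complex.Re (z2 v)).
    by apply/funext => w; case: (z1 w) => ? ?; case: (z2 w).
  by move=> v; exact: cvgD (cvgM (r1 v) (i2 v)) (cvgM (i1 v) (r2 v)).
Qed.

Lemma ccontinuous_conj z : ccontinuous z -> ccontinuous (fun v => Num.conj (z v)).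
Proof.
move=> [rz iz]; split.
- have -> // : (fun w => complex.Re (Num.conj (z w))) = (fun w => complex.Re (z w)).
  by apply/funext => w; case: (z w).
- have -> : (fun w => complex.Im (Num.conj (z w))) = (fun w => - complex.Im (z w)).
    by apply/funext => w; case: (z w).
  by move=> v; exact: cvgN (iz v).
Qed.

Lemma ccontinuous_sum (J : Type) (s : seq J) (z : J -> V -> C) :
  (forall i, ccontinuous (z i)) -> ccontinuous (fun w => \sum_(i <- s) z i w).
Proof.
move=> mz; elim: s => [|i s IH].
  by under eq_fun do rewrite big_nil; exact: ccontinuous_cst.
by under eq_fun do rewrite big_cons; exact: ccontinuousD.
Qed.

Lemma ccontinuous_mxof i j : ccontinuous (fun v => mxof v i j).
Proof.
split.
- by under eq_fun do rewrite mxE /=; exact: coord_continuous.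
- by under eq_fun do rewrite mxE /=; exact: coord_continuous.
Qed.

Lemma ccontinuous_mulmx m n p (A : V -> 'M[C]_(m, n)) (B : V -> 'M[C]_(n, p)) :
  (forall i j, ccontinuous (fun v => A v i j)) -> (forall i j, ccontinuous (fun v => B v i j)) ->
  forall i j, ccontinuous (fun v => (A v *m B v) i j).
Proof.
move=> cA cB i j; under eq_fun do rewrite mxE.
by apply: ccontinuous_sum => k; exact: ccontinuousM.
Qed.

Lemma ccontinuous_mxtrace n (A : V -> 'M[C]_n) :
  (forall i j, ccontinuous (fun v => A v i j)) -> ccontinuous (fun v => \tr (A v)).
Proof. by move=> cA; exact: ccontinuous_sum. Qed.

Lemma continuous_trXAA (A : M) : continuous (fun v => trXAA (mxof v) A).
Proof.
have cst_c m n (B : 'M[C]_(m, n)) i j : ccontinuous (fun=> B i j) by exact: ccontinuous_cst.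
have [] // : ccontinuous (fun v => \tr (mxof v *m A *m A^t*)).
apply: ccontinuous_mxtrace; apply: ccontinuous_mulmx => //.
by apply: ccontinuous_mulmx => //; exact: ccontinuous_mxof.
Qed.

Lemma closed_ccontinuous_eq z1 z2 : ccontinuous z1 -> ccontinuous z2 ->
  closed [set v | z1 v = z2 v].
Proof.
move=> c1 c2.
have [cr ci] := ccontinuousD c1 (ccontinuousM (ccontinuous_cst (-1)) c2).
have -> : [set v | z1 v = z2 v] =
    (fun v => complex.Re (z1 v + -1 * z2 v)) @^-1` [set 0] `&`
    (fun v => complex.Im (z1 v + -1 * z2 v)) @^-1` [set 0].
  apply/seteqP; split=> v /= => [->|[r0 i0]]; first by rewrite mulN1r subrr.
  apply/eqP; rewrite -subr_eq0 -mulN1r; apply/eqP.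
  by move: r0 i0; case: (_ + _) => a b /= -> ->.
by apply: closedI; apply: preimage_closed => //; exact: closed_eq.
Qed.

(** The set is an intersection of closed conditions, one for each entry and each test vector;
    nonnegativity of a complex number means imaginary part 0 and nonnegative real part. *)
Lemma closed_density : closed [set v | density (mxof v)].
Proof.
have cst_c m n (B : 'M[C]_(m, n)) i j : ccontinuous (fun=> B i j) by exact: ccontinuous_cst.
have cmx := ccontinuous_mxof.
have -> : [set v | density (mxof v)] =
    (\bigcap_(ij in [set: 'I_d * 'I_d])
       [set v | mxof v ij.1 ij.2 = Num.conj (mxof v ij.2 ij.1)]) `&`
    (\bigcap_(u in [set: 'cV[C]_d])
       ([set v | complex.Im ((u^t* *m mxof v *m u) 0 0) = 0] `&`
        [set v | 0 <= complex.Re ((u^t* *m mxof v *m u) 0 0)])) `&`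
    [set v | \tr (mxof v) = 1].
  apply/seteqP; split=> v.
    move=> [[/is_hermitianmxP vh v0] v1]; split=> //; split.
      by move=> [i j] _ /=; move: vh; rewrite expr0 scale1r => /matrixP/(_ i j); rewrite !mxE.
    by move=> u _; have := v0 u; rewrite lecE => /andP[/eqP ? ?]; split.
  move=> [[vh v0] v1]; split=> //; split.
    apply/is_hermitianmxP; rewrite expr0 scale1r; apply/matrixP => i j.
    by have := vh (i, j) Logic.I; rewrite /= !mxE.
  by move=> u; have [/= u1 u2] := v0 u Logic.I; rewrite lecE u1 eqxx.
apply: closedI; last first.
  by apply: closed_ccontinuous_eq; [exact: ccontinuous_mxtrace|exact: ccontinuous_cst].
apply: closedI; apply: closed_bigI.
  by move=> [i j] _; apply: closed_ccontinuous_eq => //; exact: ccontinuous_conj.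
move=> u _; have [cr ci] : ccontinuous (fun v => (u^t* *m mxof v *m u) 0 0).
  by apply: ccontinuous_mulmx => //; exact: ccontinuous_mulmx.
apply: closedI.
  exact: (@preimage_closed _ _ (fun v => complex.Im ((u^t* *m mxof v *m u) 0 0)) [set 0]
    (fun v _ => ci v) (@closed_eq R 0)).
exact: (@preimage_closed _ _ (fun v => complex.Re ((u^t* *m mxof v *m u) 0 0))
  [set x | 0 <= x] (fun v _ => cr v) (@closed_ge R 0)).
Qed.

(** Testing the form on e_i + c e_j with c = 1, -1, i, -i bounds both parts of X_ij by the mean of
    X_ii and X_jj. This serves both for boundedness of the density matrices and for dominating the
    entries of A A^†. *)
Lemma psd_entry_le X i j : psd X ->
  `|complex.Re (X i j)| <= complex.Re (\tr X) /\ `|complex.Im (X i j)| <= complex.Re (\tr X).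
Proof.
move=> Xp; have [/is_hermitianmxP Xh X0] := Xp.
have Xji : X j i = Num.conj (X i j).
  by move: Xh; rewrite expr0 scale1r => /matrixP/(_ j i); rewrite !mxE.
have eXe k l : ((delta_mx k 0 : 'cV[C]_d)^t* *m X *m (delta_mx l 0 : 'cV[C]_d)) 0 0 = X k l.
  rewrite trmx_delta map_delta_mx -rowE.
  have -> : row k X *m (delta_mx l 0 : 'cV[C]_d) = col l (row k X) by rewrite colE.
  by rewrite !mxE.
have diag0 k : 0 <= X k k by rewrite -eXe.
have diag_le k : complex.Re (X k k) <= complex.Re (\tr X).
  apply: Re_le; rewrite /mxtrace (bigD1 k)//= lerDl; exact: sumr_ge0.
have key c : 0 <= X i i + c * X i j + Num.conj c * X j i + Num.conj c * c * X j j.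
  have := X0 (delta_mx i 0 + c *: delta_mx j 0).
  have -> : (delta_mx i 0 + c *: delta_mx j 0 : 'cV[C]_d)^t* =
      (delta_mx i 0 : 'cV[C]_d)^t* + Num.conj c *: (delta_mx j 0 : 'cV[C]_d)^t*.
    by apply/matrixP => k l; rewrite !mxE rmorphD rmorphM.
  rewrite mulmxDl -scalemxAl mulmxDl -scalemxAl !mulmxDr -!scalemxAr.
  have mxD (A B : 'M[C]_1) : (A + B) 0 0 = A 0 0 + B 0 0 by rewrite mxE.
  have mxZ a (A : 'M[C]_1) : (a *: A) 0 0 = a * A 0 0 by rewrite mxE.
  by rewrite !(mxD, mxZ) !eXe mulrDr !mulrA addrA.
have k1 := Re_le (key 1); have k2 := Re_le (key (-1)).
have k3 := Re_le (key 'i); have k4 := Re_le (key (- 'i)).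
move: (diag_le i) (diag_le j) k1 k2 k3 k4; rewrite Xji.
case: (X i j) => a b; case: (X i i) => xi yi; case: (X j j) => xj yj; case: (\tr X) => t u /=.
by move=> *; rewrite !ler_norml; split; apply/andP; split; lra.
Qed.

Lemma compact_density : compact [set v | density (mxof v)].
Proof.
have box : compact [set v : V | forall i, `[(-1 : R), 1]%classic (v ord0 i)].
  apply: (@rV_compact _ _ (fun=> `[(-1 : R), 1]%classic)) => _.
  exact: segment_compact.
apply: subclosed_compact box _; first exact: closed_density.
move=> v [vp v1] k /=; rewrite in_itv /= -ler_norml.
have [] := psd_entry_le (enum_val k : I).1.1 (enum_val k : I).1.2 vp.
rewrite v1 !mxE /=; case E : (enum_val k : I) => [[i j] b] /=.
have -> : k = enum_rank ((i, j, b) : I) by rewrite -E enum_valK.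
by case: b {E}.
Qed.

End RealCoordinates.

(** * The two optimization problems *)

Section LneConcave.
Local Open Scope ereal_scope.
Context {R : realType}.

(** The tangent of log at [m], valid also for nonpositive [x], where the left side is -oo. Concavity
    and Jensen's inequality both rest on it. *)
Lemma lne_le_tangent (m x : R) : (0 < m)%R ->
  lne x%:E <= (ln m + (x / m - 1))%:E.
Proof.
move=> m0; have [x0|x0] := leP x 0%R; first by rewrite /= x0 leNye.
rewrite lne_EFin// lee_fin.
have -> : ln x = (ln m + ln (x / m))%R.
  by rewrite -lnM ?posrE ?divr_gt0// mulrCA mulfV ?mulr1// gt_eqF.
rewrite lerD2l -lee_fin -lne_EFin ?divr_gt0//.
have E : 1%:E + (x / m - 1)%:E = (x / m)%:E by rewrite -EFinD addrC subrK.
have := @le_lne1Dx R (x / m - 1)%:E; rewrite E; apply.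
by rewrite -EFinN lee_fin lerBrDr addNr divr_ge0 ?ltW.
Qed.

Lemma lne_concave (t x y : R) : (0 <= t <= 1)%R -> (0 <= x)%R -> (0 <= y)%R ->
  t%:E * lne x%:E + (1 - t)%:E * lne y%:E <= lne (t * x + (1 - t) * y)%:E.
Proof.
move=> /andP[t0 t1] x0 y0; have s0 : (0 <= 1 - t)%R by rewrite subr_ge0.
have [m0|m0] := ltP 0%R (t * x + (1 - t) * y)%R; last first.
  rewrite [leRHS]le0_lneNy ?lee_fin// leeNy_eq.
  (* Two nonnegative terms with nonpositive sum vanish; a zero argument with positive weight then
     makes the left side -oo. *)
  have [tx ty] : (t * x = 0 /\ (1 - t) * y = 0)%R.
    have := mulr_ge0 t0 x0; have := mulr_ge0 s0 y0; by split; lra.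
  have [t_0|t_n0] := eqVneq t 0%R.
    by move: ty; rewrite t_0 subr0 mul1r => ->; rewrite mul0e add0e mul1e le0_lneNy.
  have -> : x = 0%R by apply/eqP; move/eqP: tx; rewrite mulf_eq0 (negbTE t_n0).
  by rewrite le0_lneNy// gt0_muleNy ?addNye// lte_fin lt_def t_n0.
rewrite [leRHS]lne_EFin//; set m := (t * x + (1 - t) * y)%R in m0 *.
have tz z (c : R) : (0 <= c)%R -> c%:E * lne z%:E <= (c * (ln m + (z / m - 1)))%:E.
  by move=> c0; rewrite EFinM; apply: lee_wpmul2l; [rewrite lee_fin|exact: lne_le_tangent].
apply: (le_trans (leeD (tz x t t0) (tz y (1 - t)%R s0))).
rewrite -EFinD lee_fin le_eqVlt; apply/orP; left; apply/eqP.
have E : ((t * x + (1 - t) * y) / m = 1)%R by rewrite -/m mulfV// gt_eqF.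
have -> : (t * (ln m + (x / m - 1)) + (1 - t) * (ln m + (y / m - 1)) =
  ln m + ((t * x + (1 - t) * y) / m - 1))%R by ring.
by rewrite E subrr addr0.
Qed.

Lemma integral_lne_le d (T : measurableType d) (P : probability T R) (f : T -> R) :
  measurable_fun setT f -> (forall w, (0 <= f w)%R) ->
  \int[P]_w lne (f w)%:E <= lne (\int[P]_w (f w)%:E).
Proof.
move=> mf f0; have m0 : 0 <= \int[P]_w (f w)%:E.
  by apply: integral_ge0 => w _; rewrite lee_fin.
have mfe : measurable_fun setT (fun w => (f w)%:E) by exact/measurable_EFinP.
case E : (\int[P]_w (f w)%:E) m0 => [m| |] // m0; last exact: leey.
have qf : qintegrable P (fun w => (f w)%:E).
  by apply: qintegrable_ge0 => // [w|]; [exact: ltry|rewrite E ltry].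
(* All tangent points c are kept, not only the mean [m], because the mean may be 0. *)
have tangent (c : R) : (0 < c)%R ->
    \int[P]_w lne (f w)%:E <= (ln c - 1 + m / c)%:E.
  move=> c0; have ic : (0 <= c^-1)%R by rewrite invr_ge0 ltW.
  have qc := qintegrable_cst P (ltry (ln c - 1)%R).
  have qs := qintegrableZ ic qf.
  apply: (@le_trans _ _ (\int[P]_w (cst (ln c - 1)%:E w + (c^-1)%:E * (f w)%:E))).
    apply: le_integral_qintegrable; first exact: measurable_lne_EFin.
      by have [] := qintegrableD qc qs.
    move=> w; apply: le_trans (lne_le_tangent _ c0) _.
    by rewrite -EFinM -EFinD lee_fin; rewrite mulrC; lra.
  rewrite integral_qintegrableD// integral_cst_probability integral_qintegrableZ//.
  by rewrite E -EFinM -EFinD lee_fin mulrC.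
move: m0; rewrite lee_fin le_eqVlt => /predU1P[m_0|m_gt0].
  rewrite -m_0 le0_lneNy// leeNy_eq; apply/eqP.
  case I : (\int[P]_w lne (f w)%:E) => [r| |] //.
    (* For mean 0, a finite value [r] of the integral is refuted by the tangent at exp r, which
       gives r <= r - 1. *)
    have := tangent (expR r) (expR_gt0 r); rewrite I expRK -m_0 mul0r addr0 lee_fin.
    by rewrite lerBrDr gerDl ler10.
  by have := tangent 1%R ltr01; rewrite I.
apply: (le_trans (tangent m m_gt0)); rewrite lne_EFin// lee_fin mulfV ?gt_eqF//.
by rewrite subrK.
Qed.

End LneConcave.

Section Functionals.
Local Open Scope ereal_scope.
Context {R : realType} {d : nat} (d_gt0 : (0 < d)%N).
Local Notation C := R[i].
Local Notation M := 'M[C]_d.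
Context disp (T : measurableType disp) (P : probability T R) (A : T -> M).
Hypothesis (A_meas : random_matrix A).

Lemma measurable_trXAA_cst X : measurable_fun setT (fun w => trXAA X (A w)).
Proof. by apply: measurable_trXAA => //; exact: random_matrix_cst. Qed.

Lemma ex_log_tr_le_lne X : psd X -> ex_log_tr P A X <= lne (ex_tr P A X).
Proof.
move=> Xp; apply: integral_lne_le; first exact: measurable_trXAA_cst.
by move=> w; exact: trXAA_ge0.
Qed.

Lemma ex_tr_linear : linear_on_psd (ex_tr P A).
Proof.
move=> X Y a b Xp Yp a0 b0.
rewrite /ex_tr; under eq_integral do rewrite trXAAD !trXAAZ EFinD !EFinM.
have mX Z : measurable_fun setT (fun w => (trXAA Z (A w))%:E).
  exact/measurable_EFinP/measurable_trXAA_cst.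
have Z0 Z w : psd Z -> 0 <= (trXAA Z (A w))%:E by move=> Zp; rewrite lee_fin trXAA_ge0.
rewrite ge0_integralD//; first last.
- exact: measurable_funeM.
- by move=> w _; apply: mule_ge0; [rewrite lee_fin|exact: Z0].
- exact: measurable_funeM.
- by move=> w _; apply: mule_ge0; [rewrite lee_fin|exact: Z0].
by rewrite !ge0_integralZl_EFin// => w _; exact: Z0.
Qed.

Lemma trXAA_mixed (B : M) :
  trXAA ((d%:R^-1)%:C *: 1%:M) B = (d%:R^-1 * complex.Re (\tr (B *m B^t*)))%R.
Proof. by rewrite trXAAZ /trXAA mul1mx. Qed.

(** Both sides compare with tr (B B^†), which lies above the squared largest singular value. The
    bound is uniform in [X] and so serves as majorant for Fatou. *)
Lemma trXAA_le_mixed X (B : M) : density X ->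
  (trXAA X B <= d%:R * trXAA ((d%:R^-1)%:C *: 1%:M) B)%R.
Proof.
move=> Xd; rewrite trXAA_mixed mulrA mulfV ?mul1r ?pnatr_eq0 -?lt0n//.
by apply: le_trans (trXAA_density_le d_gt0 B Xd) _; exact: sigma_max_sqr_le_tr.
Qed.

(** The functionals see [X] only through [trXAA], so semicontinuity may be tested along sequences
    for which all these traces converge. *)
Lemma density_seq_max (f : M -> \bar R) :
  (forall (u : nat -> 'rV[R]_#|{: 'I_d * 'I_d * bool}|) p (c : \bar R),
     (forall n, density (mxof (u n))) -> density (mxof p) ->
     (forall B, trXAA (mxof (u n)) B @[n --> \oo] --> trXAA (mxof p) B) ->
     (forall n, c <= f (mxof (u n))) -> c <= f (mxof p)) ->
  exists v, is_max density f v.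
Proof.
move=> usc.
have [|u p c Ku Kp up|p Kp pmax] := @compact_seq_usc_max R _ _ (f \o mxof) (@compact_density R d).
- have [v vE] := mxof_surj ((d%:R^-1)%:C *: 1%:M : M).
  by exists v; rewrite /= vE; exact: density_mixed.
- apply: usc => // B.
  exact: (cvg_comp _ _ up (@continuous_trXAA R d B p)).
- exists (f (mxof p)); split; first by exists (mxof p).
  by move=> _ [X Xd <-]; have [v vE] := mxof_surj X; rewrite -vE in Xd *; exact: pmax.
Qed.

Lemma ex_tr_max : exists v, is_max density (ex_tr P A) v.
Proof.
(* An infinite value is itself the maximum. Otherwise the value at the mixed state is finite and
   provides an integrable majorant. *)
have [[X [Xd Xy]]|fin] := pselect (exists X, density X /\ ex_tr P A X = +oo).
  by exists +oo; split; [exists X|move=> ? _; exact: leey].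
set m := (d%:R^-1)%:C *: 1%:M : M.
have [mp _] : density m := density_mixed d_gt0.
have mfin : ex_tr P A m < +oo.
  by rewrite ltey; apply/eqP => my; apply: fin; exists m; split=> //; exact: density_mixed.
apply: density_seq_max => u p c Ku [pp p1] up cu.
apply: (@reverse_fatou _ _ _ P (fun n w => (trXAA (mxof (u n)) (A w))%:E)
    (fun w => (trXAA (mxof p) (A w))%:E) (fun w => d%:R * trXAA m (A w))%R) => //.
- by move=> n; exact/measurable_EFinP/measurable_trXAA_cst.
- exact/measurable_EFinP/measurable_trXAA_cst.
- have qm : qintegrable P (fun w => (trXAA m (A w))%:E).
    apply: qintegrable_ge0 => // [|w|w]; [|exact: ltry|by rewrite lee_fin trXAA_ge0].
    exact/measurable_EFinP/measurable_trXAA_cst.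
  by have := qintegrableZ (ler0n R d) qm.
- by move=> w; rewrite mulr_ge0// trXAA_ge0.
- by move=> n w; rewrite lee_fin; exact: trXAA_le_mixed.
- by move=> w; apply: cvg_EFin; [exact: nearW|exact: up].
Qed.

(** The convex weights are complex scalars here; lying between 0 and 1 they equal their real parts,
    which reduces the claim to [density_conv]. *)
Lemma density_convex : convex_set (density : set (convex_lmodType M)).
Proof.
move=> X Y k; rewrite !inE => Xd Yd.
have k0 : (0 <= k%:num)%R by [].
have k1 : (k%:num <= 1)%R by [].
have kE := Re_ge0E k0.
have t01 : (0 <= complex.Re k%:num <= 1)%R by rewrite (Re_le k0) (Re_le k1).
have := density_conv t01 Xd Yd.
have -> : ((1 - complex.Re k%:num)%:C = 1 - k%:num)%R by rewrite -[in RHS]kE -rmorphB.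
by rewrite kE.
Qed.

End Functionals.

Section LogFunctional.
Local Open Scope ereal_scope.
Context {R : realType} {d : nat} (d_gt0 : (0 < d)%N).
Local Notation M := 'M[R[i]]_d.
Context disp (T : measurableType disp) (P : probability T R) (L : nat -> T -> M).
Hypotheses (L_meas : forall i, random_matrix (L i))
  (L_log : ex_log_plus_sigma P (L 0%N) < +oo).

Lemma ex_log_tr_max : exists v, is_max density (ex_log_tr P (L 0%N)) v.
Proof.
apply: (density_seq_max d_gt0) => u p c Ku [pp p1] up cu.
have q := qintegrableZ (ler0n R 2) (qintegrable_log_plus_sigma d_gt0 L_meas L_log).
have [mq qy _] := q.
have q0 w : 0 <= 2%:E * log_plus_sigma L w.
  by rewrite mule_ge0// log_plus_sigma_ge0.
have qfin w : 2%:E * log_plus_sigma L w \is a fin_num by rewrite ge0_fin_numE.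
apply: (@reverse_fatou _ _ _ P (fun n w => lne (trXAA (mxof (u n)) (L 0%N w))%:E)
    (fun w => lne (trXAA (mxof p) (L 0%N w))%:E)
    (fun w => fine (2%:E * log_plus_sigma L w))) => //.
- by move=> n; exact/measurable_lne_EFin/measurable_trXAA_cst.
- exact/measurable_lne_EFin/measurable_trXAA_cst.
- by move: q; congr (qintegrable P); apply/funext => w /=; rewrite fineK.
- by move=> w; rewrite fine_ge0.
- by move=> n w; rewrite fineK//; exact: lne_trXAA_density_le.
- by move=> w; apply: cvg_lne; [exact: up|exact: trXAA_ge0].
Qed.

Lemma ex_log_tr_concave : concave_on density (ex_log_tr P (L 0%N)).
Proof.
split=> [X|X Y t Xd Yd t01]; first exact: ex_log_tr_lty.
have [/= t0 t1] := andP t01; have s0 : (0 <= 1 - t)%R by rewrite subr_ge0.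
have [Xp _] := Xd; have [Yp _] := Yd.
have qX := qintegrableZ t0 (qintegrable_lne_trXAA d_gt0 L_meas L_log Xp).
have qY := qintegrableZ s0 (qintegrable_lne_trXAA d_gt0 L_meas L_log Yp).
rewrite /ex_log_tr -!integral_qintegrableZ//; try exact: qintegrable_lne_trXAA.
rewrite -integral_qintegrableD//; apply: le_integral_qintegrable.
- by have [] := qintegrableD qX qY.
- exact/measurable_lne_EFin/measurable_trXAA_cst.
- by move=> w; rewrite trXAAD !trXAAZ; apply: lne_concave => //; exact: trXAA_ge0.
Qed.

End LogFunctional.

(** * The linear objective as a trace against a Hermitian matrix *)

Section SDP.
Local Open Scope ereal_scope.
Context {R : realType} {d : nat} (d_gt0 : (0 < d)%N).
Local Notation M := 'M[R[i]]_d.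
Context disp (T : measurableType disp) (P : probability T R) (A : T -> M).
Hypotheses (A_meas : random_matrix A)
  (ex_fin : forall X, density X -> ex_tr P A X < +oo).

Let N w := A w *m (A w)^t*.

Let rN i j w := complex.Re (N w i j).
Let iN i j w := complex.Im (N w i j).

Let random_matrix_N : random_matrix N.
Proof. by apply: random_matrixM => //; exact: random_matrix_adj. Qed.

(** The functional at the mixed state is tr (A A^†) / d, so finiteness there gives integrability of
    the trace, which in turn dominates all entries. *)
Let integrable_trN : P.-integrable setT (fun w => (complex.Re (\tr (N w)))%:E).
Proof.
pose m := ((d%:R^-1)%:C *: 1%:M)%R : M.
have [mp _] : density m := density_mixed d_gt0.
have im : P.-integrable setT (fun w => (trXAA m (A w))%:E).
  apply/integrableP; split; first exact/measurable_EFinP/measurable_trXAA_cst.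
  rewrite (eq_integral (fun w => (trXAA m (A w))%:E)).
    exact: (ex_fin (density_mixed d_gt0)).
  by move=> w _; rewrite gee0_abs// lee_fin trXAA_ge0.
have := integrableZl measurableT (d%:R) im; apply: eq_integrable => // w _.
by rewrite trXAA_mixed -EFinM mulrA mulfV ?mul1r// pnatr_eq0 -lt0n.
Qed.

Let psd_N w : psd (N w).
Proof. by have := psd_gram_adj ((A w)^t*); rewrite adjmxK. Qed.

Let integrable_rN i j : P.-integrable setT (EFin \o rN i j).
Proof.
have [mr _] := (random_matrixP N).1 random_matrix_N i j.
apply: le_integrable integrable_trN => //; first exact/measurable_EFinP.
move=> w _ /=; rewrite lee_fin.
by apply: le_trans (psd_entry_le i j (psd_N w)).1 _; exact: ler_norm.
Qed.

Let integrable_iN i j : P.-integrable setT (EFin \o iN i j).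
Proof.
have [_ mi] := (random_matrixP N).1 random_matrix_N i j.
apply: le_integrable integrable_trN => //; first exact/measurable_EFinP.
move=> w _ /=; rewrite lee_fin.
by apply: le_trans (psd_entry_le i j (psd_N w)).2 _; exact: ler_norm.
Qed.

(** The entrywise expectation of A A^†; every entry is integrable, so [fine] discards no infinite
    value. *)
Let G : M := \matrix_(i, j)
  ((fine (\int[P]_w (rN i j w)%:E)) +i* (fine (\int[P]_w (iN i j w)%:E)))%C.

Let Re_tr_mul (B X : M) : complex.Re (\tr (B *m X)) =
  (\sum_i \sum_k (complex.Re (X k i) * complex.Re (B i k) +
                 (- complex.Im (X k i)) * complex.Im (B i k)))%R.
Proof.
rewrite /mxtrace raddf_sum; apply: eq_bigr => i _; rewrite mxE raddf_sum.
apply: eq_bigr => k _; case: (B i k) => a b; case: (X k i) => x y /=.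
by ring.
Qed.

Let ex_trE X : ex_tr P A X = (complex.Re (\tr (G *m X)))%:E.
Proof.
rewrite /ex_tr Re_tr_mul.
rewrite (eq_integral (fun w => \sum_i \sum_k
    ((complex.Re (X k i))%:E * (rN i k w)%:E +
     (- complex.Im (X k i))%:E * (iN i k w)%:E))); last first.
  move=> w _; rewrite /trXAA -mulmxA mxtrace_mulC Re_tr_mul -sumEFin; apply: eq_bigr => i _.
  by rewrite -sumEFin.
have ZrN i k (c : R) : P.-integrable setT (fun w => c%:E * (rN i k w)%:E).
  by apply: integrableZl => //; exact: integrable_rN.
have ZiN i k (c : R) : P.-integrable setT (fun w => c%:E * (iN i k w)%:E).
  by apply: integrableZl => //; exact: integrable_iN.
have intD i k : P.-integrable setT (fun w =>
    (complex.Re (X k i))%:E * (rN i k w)%:E + (- complex.Im (X k i))%:E * (iN i k w)%:E).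
  exact: integrableD.
rewrite integral_sum//; last by move=> i; apply: integrable_sum => // k _; exact: intD.
rewrite -sumEFin; apply: eq_bigr => i _.
rewrite integral_sum//; rewrite -sumEFin; apply: eq_bigr => k _.
rewrite integralD//.
rewrite !integralZl//; try by [exact: integrable_rN|exact: integrable_iN].
rewrite !mxE /= EFinD !EFinM !fineK//.
- exact: integrable_fin_num (integrable_iN i k).
- exact: integrable_fin_num (integrable_rN i k).
Qed.

Let G_herm : G \is hermsymmx.
Proof.
apply/is_hermitianmxP; rewrite expr0 scale1r; apply/matrixP => i j; rewrite !mxE.
have Nji w : N w i j = Num.conj (N w j i).
  have [/is_hermitianmxP Xh _] := psd_N w.
  by move: Xh; rewrite expr0 scale1r => /matrixP/(_ i j); rewrite !mxE.
have -> : \int[P]_w (rN i j w)%:E = \int[P]_w (rN j i w)%:E.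
  by apply: eq_integral => w _; rewrite /rN Nji; case: (N w j i).
have -> : \int[P]_w (iN i j w)%:E = - \int[P]_w (iN j i w)%:E.
  rewrite -mulN1e -(integralZl measurableT (integrable_iN j i)).
  apply: eq_integral => w _; rewrite /iN /= Nji; case: (N w j i) => a b /=.
  by rewrite -EFinM mulN1r.
by rewrite fineN.
Qed.

Lemma ex_tr_semidefinite_program : semidefinite_program density (ex_tr P A).
Proof.
(* A single constraint, tr (1 X) = 1, describes the density matrices among the psd ones. *)
exists G, 1%N, (fun=> 1%:M), (fun=> 1%R); split => //.
- by move=> _; apply/is_hermitianmxP; rewrite expr0 scale1r trmx1 map_mx1.
- apply/seteqP; split=> X [Xp X1]; split=> //.
    by move=> _; rewrite mul1mx.
  by have := X1 ord0; rewrite mul1mx.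
Qed.

End SDP.

Local Open Scope ereal_scope.

Theorem proposition3p6 (R : realType) (disp : measure_display)
  (T : measurableType disp) (P : probability T R)
  (d : nat) (d_gt0 : (0 < d)%N)
  (S : set 'M[R[i]]_d) (S_mul : forall A B, S A -> S B -> S (A *m B))
  (L : nat -> T -> 'M[R[i]]_d)
  (L_S : forall i w, S (L i w))
  (L_meas : forall i, random_matrix (L i))
  (L_indep : independent_matrices P L)
  (L_id : identically_distributed P L)
  (L_log : ex_log_plus_sigma P (L 0%N) < +oo) :
  (* the limit defining the maximal Lyapunov exponent exists *)
  cvgn (lyapunov_seq P L) /\
  (* both maxima are attained, and the two bounds hold *)
  (exists v1 v2 : \bar R,
    [/\ is_max density (ex_log_tr P (L 0%N)) v1,
        is_max density (ex_tr P (L 0%N)) v2,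
        2%:E * lyapunov_max P L <= v1 &
        v1 <= lne v2]) /\
  (* the first bound is a convex optimization problem *)
  (convex_set (density : set (convex_lmodType 'M[R[i]]_d)) /\
   concave_on density (ex_log_tr P (L 0%N))) /\
  (* the second maximization is a semidefinite program *)
  (linear_on_psd (ex_tr P (L 0%N)) /\
   ((forall X, density X -> ex_tr P (L 0%N) X < +oo) ->
    semidefinite_program density (ex_tr P (L 0%N)))).
Proof.
split; first exact: is_cvg_lyapunov.
split; last first.
  split; first by split; [exact: density_convex|exact: ex_log_tr_concave].
  by split=> [|fin]; [exact: ex_tr_linear|exact: ex_tr_semidefinite_program].
have [v1 v1_max] := ex_log_tr_max d_gt0 L_meas L_log.
have [v2 v2_max] := ex_tr_max d_gt0 P (L_meas 0%N).
exists v1, v2; split=> //.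
  have [[X Xd Xv1] v1_ub] := v1_max.
  apply: lyapunov_max_le => //.
    (* The maximum is attained, so it inherits the bound below +oo that holds at each density
       matrix. *)
    by rewrite -Xv1; exact: ex_log_tr_lty.
  by move=> Y Yd; apply: v1_ub; exists Y.
(* Jensen's inequality is applied at a maximizer of the first problem, whose expected trace is at
   most the second maximum. *)
have [[X Xd <-] _] := v1_max; have [_ v2_ub] := v2_max.
have [Xp _] := Xd.
apply: le_trans (ex_log_tr_le_lne P (L_meas 0%N) Xp) _.
by apply: le_lne; apply: v2_ub; exists X.
Qed.
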